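(* Consider the broken sample detection problem for the Bernoulli model: $\mathcal X=\mathcal Y=\{0,1\}^d$ and $\mathsf P_{X,Y}=\mathsf p^{\otimes d}$, where $\mathsf p$ is the joint distribution of two Bernoulli random variables, each with success probability $q$, with correlation coefficient $\rho\in[-\min\{\frac q{1-q},\frac{1-q}q\},1]$. Here $q=q_n$ and $\rho=\rho_n$ may depend on $n$, $q\le1/2$, and $m=\alpha n$ for a constant $\alpha\in(0,1]$. The necessary and sufficient condition for strong detection as $n\to\infty$ is as follows: - if $d$ is fixed (not depending on $n$): $\alpha=1$, $\rho^2=1-o(1)$, and $nq=\omega(1)$; - if $d=d_n\to\infty$ as $n\to\infty$: $\rho^2d=\omega(1)$ and $ndq|\rho|=\omega(1)$.
   Context: Notation: $a_n=\omega(1)$ means $a_n\to\infty$. Explicitly, $\mathsf p(0,0)=(1-q)(1-q+\rho q)$, $\mathsf p(1,0)=\mathsf p(0,1)=q(1-q)(1-\rho)$, $\mathsf p(1,1)=q(q+\rho(1-q))$; $\mathsf p^{\otimes d}$ means the $d$ coordinate pairs are i.i.d. from $\mathsf p$. Broken sample detection problem. $\mathsf P_{X,Y}$ is a known joint distribution on $\mathcal X\times\mathcal Y$ with marginals $\mathsf P_X,\mathsf P_Y$. One observes $\mathbf X=(X_1,\dots,X_n)\in\mathcal X^n$ and $\mathbf Y=(Y_1,\dots,Y_m)\in\mathcal Y^m$, $m\le n$. Under $\mathcal H_0$: $(\mathbf X,\mathbf Y)\sim \mathsf P_X^{\otimes n}\otimes\mathsf P_Y^{\otimes m}$. Under $\mathcal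 H_1$: $\pi$ is drawn uniformly from the set $S_{m,n}$ of injections $[m]\to[n]$, and conditionally on $\pi$ the pairs $(X_{\pi(i)},Y_i)$, $i\in[m]$, are i.i.d. from $\mathsf P_{X,Y}$ and, independently, the $X_j$, $j\in[n]\setminus\pi([m])$, are i.i.d. from $\mathsf P_X$. Only $(\mathbf X,\mathbf Y)$ is observed. Strong detection is possible if there is a sequence of tests (based on $(\mathbf X,\mathbf Y)$) whose Type-I and Type-II error probabilities both tend to $0$ as $n\to\infty$. Here $m=\alpha n$ is read as $m=\lfloor\alpha n\rfloor$ when $\alpha n$ is not an integer. *)

(* Defs.v *)
From HB Require Import structures.
From mathcomp Require Import all_boot all_order all_algebra.
From mathcomp Require Import all_classical all_reals all_analysis.

Set Implicit Arguments.
Unset Strict Implicit.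
Unset Printing Implicit Defensive.

Import Order.TTheory GRing.Theory Num.Theory.
Import numFieldNormedType.Exports.

Local Open Scope classical_set_scope.
Local Open Scope ring_scope.

(* Laws on finite spaces are given by their probability mass functions; a joint
   law of (X, Y) is a function of two arguments. *)

Definition marginalX (R : realType) (X Y : finType) (P : X -> Y -> R) (x : X) : R :=
  \sum_(y : Y) P x y.

Definition marginalY (R : realType) (X Y : finType) (P : X -> Y -> R) (y : Y) : R :=
  \sum_(x : X) P x y.

Definition injections (m n : nat) : {set {ffun 'I_m -> 'I_n}} :=
  [set s : {ffun 'I_m -> 'I_n} | injectiveb s].

Definition null_law (R : realType) (X Y : finType) (P : X -> Y -> R) (n m : nat)
    (x : {ffun 'I_n -> X}) (y : {ffun 'I_m -> Y}) : R :=
  (\prod_(j < n) marginalX P (x j)) * (\prod_(i < m) marginalY P (y i)).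

Definition planted_law_given (R : realType) (X Y : finType) (P : X -> Y -> R)
    (n m : nat) (s : {ffun 'I_m -> 'I_n})
    (x : {ffun 'I_n -> X}) (y : {ffun 'I_m -> Y}) : R :=
  (\prod_(i < m) P (x (s i)) (y i)) *
  (\prod_(j < n | j \notin codom s) marginalX P (x j)).

(* Observed law under the alternative: the latent injection, uniform on
   [injections m n], is averaged out. *)
Definition planted_law (R : realType) (X Y : finType) (P : X -> Y -> R) (n m : nat)
    (x : {ffun 'I_n -> X}) (y : {ffun 'I_m -> Y}) : R :=
  \sum_(s in injections m n)
    (#|injections m n|%:R)^-1 * planted_law_given P s x y.

Definition event_prob (R : realType) (A B : finType) (L : A -> B -> R)
    (E : A -> B -> bool) : R :=
  \sum_(a : A) \sum_(b : B | E a b) L a b.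

(* A test returns [true] when it rejects the null hypothesis. *)
Definition type1_error (R : realType) (X Y : finType) (P : X -> Y -> R) (n m : nat)
    (phi : {ffun 'I_n -> X} -> {ffun 'I_m -> Y} -> bool) : R :=
  event_prob (@null_law R X Y P n m) phi.

Definition type2_error (R : realType) (X Y : finType) (P : X -> Y -> R) (n m : nat)
    (phi : {ffun 'I_n -> X} -> {ffun 'I_m -> Y} -> bool) : R :=
  event_prob (@planted_law R X Y P n m) (fun x y => ~~ phi x y).

(* The alphabets, the joint law and the sample size [m] may all depend on [n],
   and so may the test. *)
Definition strong_detection (R : realType) (X Y : nat -> finType)
    (P : forall n, X n -> Y n -> R) (m : nat -> nat) : Prop :=
  exists phi : forall n, {ffun 'I_n -> X n} -> {ffun 'I_(m n) -> Y n} -> bool,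
    (type1_error (P n) (phi n) @[n --> \oo] --> (0 : R)) /\
    (type2_error (P n) (phi n) @[n --> \oo] --> (0 : R)).

Definition bernoulli_pair (R : realType) (q rho : R) (a b : bool) : R :=
  match a, b with
  | false, false => (1 - q) * (1 - q + rho * q)
  | true, true => q * (q + rho * (1 - q))
  | _, _ => q * (1 - q) * (1 - rho)
  end.

Definition iid_pair (R : realType) (p : bool -> bool -> R) (d : nat)
    (u v : {ffun 'I_d -> bool}) : R :=
  \prod_(k < d) p (u k) (v k).

(* [Num.truncn] is the floor on nonnegative reals. *)
Definition bernoulli_strong_detection (R : realType) (alpha : R) (q rho : nat -> R)
    (d : nat -> nat) : Prop :=
  strong_detection
    (fun n => @iid_pair R (bernoulli_pair (q n) (rho n)) (d n))
    (fun n => Num.truncn (alpha * n%:R)).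

(* Main.v *)
Require Import Defs.
From HB Require Import structures.
From mathcomp Require Import all_boot all_order all_algebra.
From mathcomp Require Import all_classical all_reals all_analysis.
From mathcomp Require Import fingroup perm.
From mathcomp Require Import complex.
From mathcomp Require Import ring lra.

Set Implicit Arguments.
Unset Strict Implicit.
Unset Printing Implicit Defensive.

Import Order.TTheory GRing.Theory Num.Theory.
Import numFieldNormedType.Exports.

Local Open Scope classical_set_scope.
Local Open Scope ring_scope.

(** Both implications compare the null law with the planted law through their
    likelihood ratio [L].

    Necessity.  The joint law of a pair is diagonal in the Walsh basis, with
    eigenvalue [rho ^+ #|S|] for a set [S] of coordinates.  Expanding [L] in the
    corresponding tensor basis, its second moment under the null becomes a sum
    over colourings of the samples of the probability that two independent
    uniform injections transport the colouring in the same way.  Symmetry under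
    permutations of the samples bounds it ([likelihood_second_moment_le]) by the
    product over nonempty [S] of [(1 - m / n * rho ^+ (2 * #|S|))^-1].  A bounded
    second moment excludes strong detection ([second_moment_errors]).  For fixed
    [d] the product is bounded unless [alpha * rho ^+ 2] is close to [1], which
    forces [alpha = 1] and [rho ^+ 2] to tend to [1]; for growing [d] it is at most
    [expR (2 * expR (rho ^+ 2 * d))] as soon as [rho ^+ 2 <= 1 / 2].  The other
    condition comes from the direct overlap of the two laws given the matching,
    [(1 - 2 * q * (1 - q) * `|rho|) ^+ (d * m)] ([iid_bernoulli_errors_ge]), which is
    bounded below while [n d q |rho|] is bounded.

    Sufficiency, growing dimension.  Sum over the coordinates the product of the
    centred column sums of the two samples.  This statistic does not see the
    matching; its mean is [0] under the null and proportional to [rho] under the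
    alternative.  Its variance has a part determined by the covariances of the
    bits, negligible when [rho ^+ 2 * d] is large, and a part from the fourth
    moments of single bit pairs, negligible when [n d q |rho|] is large
    ([cross_test_errors]).

    Sufficiency, fixed dimension.  With [alpha = 1] the numbers of ones in one
    coordinate of the two samples nearly determine each other when [rho ^+ 2] is
    close to [1], whereas under the null their centred difference, or sum if
    [rho] is negative, is spread over a scale [sqrt (n q)] that tends to
    infinity.  The spreading is proved with characteristic functions and a Fejer
    kernel ([balance_test_errors]). *)

(** * Sums over matched samples *)

Lemma big_codom (T : Type) (idx : T) (op : Monoid.com_law idx) (m n : nat)
    (s : {ffun 'I_m -> 'I_n}) (F : 'I_n -> T) :
  injective s ->
  \big[op/idx]_(j in codom s) F j = \big[op/idx]_(i < m) F (s i).
Proof.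
move=> s_inj; have codom_uniq : uniq (codom s).
  by rewrite map_inj_uniq ?enum_uniq.
by rewrite -(big_uniq _ codom_uniq) /= big_map big_enum.
Qed.

(** Independence of the matched pairs and of the unmatched samples: summing out
    the matched partner of [x (s i)] turns the weight into a product over the
    positions of [x], and a sum of products over all functions is a product of
    sums. *)
Lemma sum_coupled (R : realType) (X Y : finType) (m n : nat)
    (s : {ffun 'I_m -> 'I_n}) (Q : 'I_m -> X -> Y -> R) (r : 'I_n -> X -> R) :
  injective s ->
  \sum_(x : {ffun 'I_n -> X}) \sum_(y : {ffun 'I_m -> Y})
     (\prod_(i < m) Q i (x (s i)) (y i)) *
     (\prod_(j < n | j \notin codom s) r j (x j)) =
  (\prod_(i < m) \sum_(a : X) \sum_(b : Y) Q i a b) *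
  (\prod_(j < n | j \notin codom s) \sum_(a : X) r j a).
Proof.
move=> s_inj.
pose G j a := if [pick i | s i == j] is Some i then \sum_b Q i a b else r j a.
have Gs i a : G (s i) a = \sum_b Q i a b.
  rewrite /G; case: pickP => [i' /eqP/s_inj -> //|/(_ i)].
  by rewrite eqxx.
have Gn j a : j \notin codom s -> G j a = r j a.
  rewrite /G; case: pickP => [i /eqP <-|//].
  by rewrite codom_f.
transitivity (\sum_(x : {ffun 'I_n -> X}) \prod_j G j (x j)).
  apply: eq_bigr => x _; rewrite -big_distrl /=.
  rewrite -(bigA_distr_bigA (fun i b => Q i (x (s i)) b)).
  rewrite [RHS](bigID (mem (codom s))) /= big_codom //.
  by congr (_ * _); apply: eq_bigr => i Hi; rewrite ?Gs ?Gn.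
rewrite -(bigA_distr_bigA G) (bigID (mem (codom s))) /= big_codom //.
congr (_ * _); apply: eq_bigr => i Hi; apply: eq_bigr => a _.
  by rewrite Gs.
by rewrite Gn.
Qed.

(** * Colourings of the samples and uniform injections *)

Definition colour_count (K : finType) (n : nat) (a : {ffun 'I_n -> K}) (k : K) :
  nat := #|[set j | a j == k]%SET|.

Lemma colour_countE (K : finType) (n : nat) (a : {ffun 'I_n -> K}) (k : K) :
  colour_count a k = (\sum_(j < n) (a j == k))%N.
Proof. by rewrite /colour_count cardsE -sum1_card big_mkcond. Qed.

Lemma sum_colour_count (K : finType) (n : nat) (a : {ffun 'I_n -> K}) :
  (\sum_k colour_count a k)%N = n.
Proof.
under eq_bigr do rewrite colour_countE.
rewrite exchange_big /= -[RHS]card_ord -sum1_card; apply: eq_bigr => j _.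
rewrite (bigD1 (a j)) //= eqxx big1 // => k /negPf.
by rewrite eq_sym => ->.
Qed.

(** The count of colour [k0] is what the other colours leave of [n], so all counts
    agree and the two sequences of colours are rearrangements of each other. *)
Lemma same_colours_perm (K : finType) (k0 : K) (n : nat)
    (a b : {ffun 'I_n -> K}) :
  (forall k, k != k0 -> colour_count a k = colour_count b k) ->
  exists sigma : {perm 'I_n}, forall j, b j = a (sigma j).
Proof.
move=> ab.
have {}ab k : colour_count a k = colour_count b k.
  have [-> {k}|/ab//] := eqVneq k k0.
  have := sum_colour_count a; rewrite -{2}(sum_colour_count b).
  rewrite (bigD1 k0) //= [in RHS](bigD1 k0) //=.
  by rewrite (eq_bigr _ ab) => /addIn.
have count_col (c : {ffun 'I_n -> K}) k :
    count_mem k [tuple c j | j < n] = colour_count c k.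
  by rewrite /= count_map -sum1_count big_enum_cond big_mkcond colour_countE.
have /tuple_permP[sigma eq_ba] :
    perm_eq [tuple b j | j < n] [tuple a j | j < n].
  by apply/allP => k _ /=; rewrite !count_col ab.
exists sigma => j.
have := congr1 (fun u => nth (b j) u j) eq_ba.
by rewrite -!tnth_nth !tnth_mktuple.
Qed.

Lemma inj_injections (m n : nat) (s : {ffun 'I_m -> 'I_n}) :
  s \in injections m n -> injective s.
Proof. by rewrite inE => /injectiveP. Qed.

Lemma injections_exists (m n : nat) :
  (m <= n)%N -> exists s, s \in injections m n.
Proof.
move=> mn; exists [ffun i => widen_ord mn i]; rewrite inE; apply/injectiveP.
by move=> i j; rewrite !ffunE => /(congr1 val)/= /val_inj.
Qed.

Definition relabel (m n : nat) (sigma : {perm 'I_n}) (s : {ffun 'I_m -> 'I_n}) :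
  {ffun 'I_m -> 'I_n} := [ffun i => sigma (s i)].

Lemma relabel_inj (m n : nat) (sigma : {perm 'I_n}) :
  injective (@relabel m n sigma).
Proof.
move=> s s' eq_s; apply/ffunP => i.
by have /ffunP/(_ i) := eq_s; rewrite !ffunE => /perm_inj.
Qed.

Lemma relabel_injections (m n : nat) (sigma : {perm 'I_n}) (s : {ffun 'I_m -> 'I_n}) :
  s \in injections m n -> relabel sigma s \in injections m n.
Proof.
move=> /inj_injections s_inj; rewrite inE; apply/injectiveP => i j.
by rewrite !ffunE => /perm_inj /s_inj.
Qed.

Definition covering (m n : nat) (A : {set 'I_n}) : {set {ffun 'I_m -> 'I_n}} :=
  [set s in injections m n | A \subset codom s].

Lemma in_covering (m n : nat) (A : {set 'I_n}) (s : {ffun 'I_m -> 'I_n}) :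
  (s \in covering m A) = (s \in injections m n) && (A \subset codom s).
Proof. by rewrite inE. Qed.

Lemma card_covering_exchange (m n : nat) (A : {set 'I_n}) (i j : 'I_n) :
  i \notin A -> j \notin A ->
  (#|covering m (i |: A)| <= #|covering m (j |: A)|)%N.
Proof.
move=> iA jA; rewrite -(card_imset _ (@relabel_inj m n (tperm i j))).
apply: subset_leq_card; apply/fintype.subsetP => _ /imsetP[s + ->].
rewrite inE => /andP[s_inj sA].
rewrite inE relabel_injections //=; apply/fintype.subsetP => k.
have in_relabel l : l \in codom s -> tperm i j l \in codom (relabel (tperm i j) s).
  by case/codomP => u ->; apply/codomP; exists u; rewrite ffunE.
rewrite in_setU1 => /orP[/eqP->|kA].
  rewrite -[X in X \in _](tpermL i j); apply/in_relabel/(fintype.subsetP sA).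
  exact: setU11.
have kE : tperm i j k = k.
  by apply: tpermD; [apply: contraNneq iA => -> | apply: contraNneq jA => ->].
rewrite -[X in X \in _]kE; apply/in_relabel/(fintype.subsetP sA).
by rewrite in_setU1 kA orbT.
Qed.

(** Extending [A] by any of the [n - #|A|] missing points gives equally many
    injections, by exchanging two points of the range; and an injection that
    covers [A] covers exactly [m - #|A|] further points. *)
Lemma card_covering_step (m n : nat) (A : {set 'I_n}) (j : 'I_n) :
  j \notin A ->
  ((n - #|A|) * #|covering m (j |: A)| <= (m - #|A|) * #|covering m A|)%N.
Proof.
move=> jA.
have -> : (n - #|A| = #|~: A|)%N by rewrite [RHS]cardsCs finset.setCK card_ord.
rewrite -sum_nat_const.
apply: (@leq_trans (\sum_(i in ~: A) #|covering m (i |: A)|)%N).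
  by apply: leq_sum => i; rewrite inE => iA; exact: card_covering_exchange.
under eq_bigr do rewrite -sum1_card big_mkcond.
rewrite exchange_big /= mulnC -sum_nat_const [leqRHS]big_mkcond /=.
apply: leq_sum => s _; case: ifPn => [|sA].
  rewrite inE => /andP[s_inj sA].
  rewrite -big_mkcondr sum1_card.
  have -> : (m - #|A| = #|codom s| - #|A|)%N.
    by rewrite card_codom ?card_ord //; exact: inj_injections.
  rewrite -[#|codom s|](cardID (mem A)).
  rewrite (_ : #|[predI codom s & A]| = #|A|); last first.
    apply: eq_card => k; rewrite !inE andbC.
    by case: (boolP (k \in A)) => // /(fintype.subsetP sA) ->.
  rewrite addKn; apply: subset_leq_card; apply/fintype.subsetP => k.
  rewrite inE => /andP[]; rewrite finset.in_setC in_covering s_inj /= => kA.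
  move=> /fintype.subsetP kAs; rewrite [_ \notin _]kA /=.
  by apply: kAs; exact: setU11.
rewrite big1 // => i iA; rewrite ifN //; apply: contra sA.
rewrite !in_covering => /andP[-> /= /fintype.subsetP sA].
by apply/fintype.subsetP => k kA; apply: sA; rewrite in_setU1 kA orbT.
Qed.

(** The chance that a uniform injection covers [A] is at most
    [(m / n) ^ #|A|]: each further point costs a factor
    [(m - r) / (n - r) <= m / n]. *)
Lemma card_covering (m n : nat) (A : {set 'I_n}) :
  (m <= n)%N ->
  (#|covering m A| * n ^ #|A| <= m ^ #|A| * #|injections m n|)%N.
Proof.
move=> mn; move: {2}#|A| (erefl #|A|) => r.
elim: r A => [|r IHr] A cardA; rewrite cardA.
  rewrite !expn0 muln1 mul1n; apply: subset_leq_card.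
  by apply/fintype.subsetP => s; rewrite inE => /andP[].
have /card_gt0P[j jA] : (0 < #|A|)%N by rewrite cardA.
have jAj : j \notin A :\ j by rewrite !inE eqxx.
have cardAj : #|A :\ j| = r by move: cardA; rewrite (cardsD1 j) jA => -[].
have rn : (r < n)%N by rewrite -[n]card_ord -cardA max_card.
have := card_covering_step m jAj; rewrite finset.setD1K // cardAj => step.
have := IHr _ cardAj; rewrite cardAj => IH.
rewrite -(@leq_pmul2l (n - r)) ?subn_gt0 // !expnS.
have mr : ((m - r) * n <= m * (n - r))%N.
  by rewrite mulnBl mulnBr leq_sub2l // mulnC leq_mul2l mn orbT.
apply: (@leq_trans (((m - r) * n) * (#|covering m (A :\ j)| * n ^ r))%N).
  rewrite [leqLHS](_ : _ = ((n - r) * #|covering m A|) * (n * n ^ r))%N; last first.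
    by rewrite mulnA.
  rewrite [leqRHS](_ : _ =
    ((m - r) * #|covering m (A :\ j)|) * (n * n ^ r))%N ?leq_mul2r ?step ?orbT //.
  by rewrite mulnACA.
rewrite [leqRHS](_ : _ = (m * (n - r)) * (m ^ r * #|injections m n|))%N.
  exact: leq_mul.
by rewrite -mulnA mulnCA mulnA.
Qed.

(** In an expansion over a basis whose element [k0] is the constant [1], the
    colour [c i] attached to [y i] is carried to its partner [x (s i)], and
    unmatched samples get the colour [k0]. *)
Definition transport (K : finType) (k0 : K) (m n : nat)
    (s : {ffun 'I_m -> 'I_n}) (c : {ffun 'I_m -> K}) : {ffun 'I_n -> K} :=
  [ffun j => if [pick i | s i == j] is Some i then c i else k0].

Lemma transport_codom (K : finType) (k0 : K) (m n : nat)
    (s : {ffun 'I_m -> 'I_n}) (c : {ffun 'I_m -> K}) (i : 'I_m) :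
  injective s -> transport k0 s c (s i) = c i.
Proof.
move=> s_inj; rewrite ffunE; case: pickP => [i' /eqP/s_inj -> //|/(_ i)].
by rewrite eqxx.
Qed.

Lemma transport_out (K : finType) (k0 : K) (m n : nat)
    (s : {ffun 'I_m -> 'I_n}) (c : {ffun 'I_m -> K}) (j : 'I_n) :
  j \notin codom s -> transport k0 s c j = k0.
Proof.
by rewrite ffunE; case: pickP => [i /eqP <-|//]; rewrite codom_f.
Qed.

Lemma transport_inj (K : finType) (k0 : K) (m n : nat) (s : {ffun 'I_m -> 'I_n}) :
  injective s -> injective (transport k0 s).
Proof.
move=> s_inj c c' eq_c; apply/ffunP => i.
by rewrite -(transport_codom k0 c i s_inj) eq_c transport_codom.
Qed.

Lemma colour_count_transport (K : finType) (k0 : K) (m n : nat)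
    (s : {ffun 'I_m -> 'I_n}) (c : {ffun 'I_m -> K}) (k : K) :
  injective s -> k != k0 ->
  colour_count (transport k0 s c) k = colour_count c k.
Proof.
move=> s_inj kk0; rewrite !colour_countE (bigID (mem (codom s))) /=.
rewrite big_codom // [X in (_ + X)%N]big1 => [|j jNs].
  by rewrite addn0; apply: eq_bigr => i _; rewrite transport_codom.
by rewrite transport_out // eq_sym (negPf kk0).
Qed.

Lemma transport_relabel (K : finType) (k0 : K) (m n : nat)
    (sigma : {perm 'I_n}) (s : {ffun 'I_m -> 'I_n}) (c : {ffun 'I_m -> K})
    (j : 'I_n) :
  transport k0 (relabel sigma s) c (sigma j) = transport k0 s c j.
Proof.
rewrite !ffunE; congr (if _ is Some i then c i else k0).
by apply: eq_pick => i; rewrite ffunE (inj_eq perm_inj).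
Qed.

Definition reaching (K : finType) (k0 : K) (m n : nat) (c : {ffun 'I_m -> K})
    (b : {ffun 'I_n -> K}) : {set {ffun 'I_m -> 'I_n}} :=
  [set s in injections m n | transport k0 s c == b].

Lemma in_reaching (K : finType) (k0 : K) (m n : nat) (c : {ffun 'I_m -> K})
    (b : {ffun 'I_n -> K}) (s : {ffun 'I_m -> 'I_n}) :
  (s \in reaching k0 c b) = (s \in injections m n) && (transport k0 s c == b).
Proof. by rewrite inE. Qed.

Lemma card_reaching_le (K : finType) (k0 : K) (m n : nat)
    (c : {ffun 'I_m -> K}) (b b' : {ffun 'I_n -> K}) :
  (forall k, k != k0 -> colour_count b k = colour_count b' k) ->
  (#|reaching k0 c b| <= #|reaching k0 c b'|)%N.
Proof.
case/same_colours_perm => sigma b'E.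
rewrite -(card_imset _ (@relabel_inj m n (sigma^-1)%g)).
apply: subset_leq_card; apply/fintype.subsetP => _ /imsetP[s + ->].
rewrite !in_reaching => /andP[s_inj /eqP sb]; rewrite relabel_injections //=.
apply/eqP/ffunP => j; rewrite b'E -sb -(transport_relabel k0 (sigma^-1)%g).
by rewrite permK.
Qed.

(** Permuting the samples permutes the uniform injections, so the chance of
    reaching [b] depends only on the colour counts of [b]. *)
Lemma card_reaching_eq (K : finType) (k0 : K) (m n : nat)
    (c : {ffun 'I_m -> K}) (b b' : {ffun 'I_n -> K}) :
  (forall k, k != k0 -> colour_count b k = colour_count b' k) ->
  #|reaching k0 c b| = #|reaching k0 c b'|.
Proof.
move=> bb'; apply/eqP; rewrite eqn_leq !card_reaching_le // => k kk0.
by rewrite bb'.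
Qed.

(** An injection determines the colouring of the matched samples that it
    carries to [b], and there is one only if it matches all samples of colour
    other than [k0]. *)
Lemma sum_card_reaching (K : finType) (k0 : K) (m n : nat)
    (b : {ffun 'I_n -> K}) :
  (\sum_(c : {ffun 'I_m -> K}) #|reaching k0 c b| <=
   #|covering m [set j | b j != k0]%SET|)%N.
Proof.
under eq_bigr do rewrite -sum1_card big_mkcond.
rewrite exchange_big /= -sum1_card [leqRHS]big_mkcond /=.
apply: leq_sum => s _; rewrite -big_mkcond sum1dep_card in_covering.
have [s_inj|s_ninj] := boolP (s \in injections m n); last first.
  rewrite leqn0 cards_eq0; apply/eqP/setP => c.
  by rewrite finset.in_set0 finset.in_set in_reaching (negPf s_ninj).
have s_inj' := inj_injections s_inj.
rewrite /=; case: ifPn => [_|/subsetPn[j]].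
  apply/card_le1_eqP => c c'; rewrite [c \in _]finset.in_set [c' \in _]finset.in_set.
  rewrite !in_reaching s_inj /=.
  by move=> /eqP <- /eqP /(transport_inj s_inj').
rewrite inE => bj jNs; rewrite leqn0 cards_eq0; apply/eqP/setP => c.
rewrite finset.in_set0 finset.in_set in_reaching s_inj /=.
by apply: contraNF bj => /eqP <-; rewrite transport_out.
Qed.

Lemma colour_count_nonzero (K : finType) (k0 : K) (n : nat)
    (b : {ffun 'I_n -> K}) :
  (\sum_(k | k != k0) colour_count b k)%N = #|[set j | b j != k0]%SET|.
Proof.
under eq_bigr do rewrite colour_countE.
rewrite exchange_big /= -sum1_card [RHS]big_mkcond /=.
apply: eq_bigr => j _; rewrite inE; case: ifPn => [bj|/negPn/eqP ->].
  rewrite (bigD1 (b j)) //= eqxx big1 // => k /andP[_ /negPf].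
  by rewrite eq_sym => ->.
by rewrite big1 // => k /negPf; rewrite eq_sym => ->.
Qed.

(** Over the colourings with given counts [mu], the chances that two
    independent uniform injections agree add up to at most
    [(m / n) ^ (sum of mu)].  By invariance the common value may be replaced by
    one fixed colouring [b]; the events of reaching [b] are then disjoint, and
    their union is the event that all nontrivially coloured samples of [b] are
    matched. *)
Lemma sum_same_colours (R : realType) (K : finType) (k0 : K) (m n : nat)
    (mu : K -> nat) (s0 : {ffun 'I_m -> 'I_n}) :
  (m <= n)%N -> s0 \in injections m n ->
  \sum_(c : {ffun 'I_m -> K} |
        [forall (k | k != k0), colour_count c k == mu k])
     #|reaching k0 c (transport k0 s0 c)|%:R / #|injections m n|%:R
  <= (m%:R / n%:R) ^+ (\sum_(k | k != k0) mu k)%N :> R.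
Proof.
move=> mn s0_inj; have s0_inj' := inj_injections s0_inj.
have [c0 /forall_inP c0mu|nomu] :=
    pickP (fun c : {ffun 'I_m -> K} =>
             [forall (k | k != k0), colour_count c k == mu k]); last first.
  rewrite (eq_bigl _ _ nomu) big_pred0_eq.
  by apply: exprn_ge0; apply: divr_ge0; exact: ler0n.
pose b := transport k0 s0 c0.
have b_mu k : k != k0 -> colour_count b k = mu k.
  by move=> kk0; rewrite colour_count_transport //; apply/eqP/c0mu.
have N_gt0 : (0 < #|injections m n|)%N by apply/card_gt0P; exists s0.
have r_eq : (\sum_(k | k != k0) mu k)%N = #|[set j | b j != k0]%SET|.
  by rewrite -colour_count_nonzero; apply: eq_bigr => k /b_mu.
rewrite -mulr_suml ler_pdivrMr ?ltr0n // -natr_sum.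
apply: (@le_trans _ _ (#|covering m [set j | b j != k0]%SET|%:R)).
  rewrite ler_nat; apply: leq_trans (sum_card_reaching k0 m b).
  rewrite big_mkcond /=; apply: leq_sum => c _.
  case: ifPn => // /forall_inP cmu; rewrite (@card_reaching_eq _ _ _ _ _ _ b) //.
  by move=> k kk0; rewrite b_mu // colour_count_transport //; apply/eqP/cmu.
have r_le : (#|[set j | b j != k0]%SET| <= n)%N by rewrite -[leqRHS]card_ord max_card.
rewrite r_eq expr_div_n mulrAC ler_pdivlMr; last first.
  rewrite -natrX ltr0n expn_gt0; case: posnP => //= n0.
  by move: (leq_trans r_le (eq_leq n0)); rewrite leqn0.
by rewrite -!natrX -!natrM ler_nat card_covering.
Qed.

(** * Second moment of the likelihood ratio of a diagonal kernel *)

(** An eigenfunction expansion of the likelihood ratio of a pair with both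
    marginals [p], normalized so that [k0] indexes the constant function. *)
Definition diagonal_law (R : realType) (X K : finType) (P : X -> X -> R)
    (p : X -> R) (k0 : K) (lam : K -> R) (f : K -> X -> R) : Prop :=
  [/\ forall k l, \sum_x p x * (f k x * f l x) = (k == l)%:R,
      forall x, f k0 x = 1,
      lam k0 = 1 &
      forall x y, P x y = p x * p y * \sum_k lam k * (f k x * f k y)].

Lemma diagonal_marginalX (R : realType) (X K : finType) (P : X -> X -> R)
    (p : X -> R) (k0 : K) (lam : K -> R) (f : K -> X -> R) (x : X) :
  diagonal_law P p k0 lam f -> marginalX P x = p x.
Proof.
move=> [orth f0 lam0 PE]; rewrite /marginalX.
transitivity (\sum_k p x * (lam k * f k x) * \sum_y p y * (f k y * f k0 y)).
  under eq_bigr do rewrite PE mulr_sumr.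
  rewrite exchange_big /=; apply: eq_bigr => k _; rewrite mulr_sumr.
  by apply: eq_bigr => y _; rewrite f0; ring.
rewrite (bigD1 k0) //= [X in _ + X]big1 => [|k /negPf kk0].
  by rewrite orth eqxx lam0 f0 /=; ring.
by rewrite orth kk0 mulr0.
Qed.

Lemma diagonal_marginalY (R : realType) (X K : finType) (P : X -> X -> R)
    (p : X -> R) (k0 : K) (lam : K -> R) (f : K -> X -> R) (y : X) :
  diagonal_law P p k0 lam f -> marginalY P y = p y.
Proof.
move=> [orth f0 lam0 PE].
rewrite -(@diagonal_marginalX R X K P p k0 lam f y) //.
by apply: eq_bigr => x _; rewrite !PE [p x * _]mulrC; congr (_ * _);
  apply: eq_bigr => k _; rewrite [f k x * _]mulrC.
Qed.

Definition product_weight (R : realType) (X Y : finType) (p : X -> R) (p' : Y -> R)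
    (n m : nat) (x : {ffun 'I_n -> X}) (y : {ffun 'I_m -> Y}) : R :=
  (\prod_(j < n) p (x j)) * (\prod_(i < m) p' (y i)).

Lemma diagonal_null_law (R : realType) (X K : finType) (P : X -> X -> R)
    (p : X -> R) (k0 : K) (lam : K -> R) (f : K -> X -> R) (n m : nat)
    (x : {ffun 'I_n -> X}) (y : {ffun 'I_m -> X}) :
  diagonal_law P p k0 lam f -> null_law P x y = product_weight p p x y.
Proof.
move=> dP; congr (_ * _); apply: eq_bigr => i _.
  exact: diagonal_marginalX dP.
exact: diagonal_marginalY dP.
Qed.

Definition tensor (R : realType) (X K : finType) (f : K -> X -> R) (n : nat)
    (c : {ffun 'I_n -> K}) (x : {ffun 'I_n -> X}) : R := \prod_j f (c j) (x j).

Lemma tensor_orthonormal (R : realType) (X K : finType) (p : X -> R)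
    (f : K -> X -> R) (n : nat) (b c : {ffun 'I_n -> K}) :
  (forall k l, \sum_x p x * (f k x * f l x) = (k == l)%:R) ->
  \sum_(x : {ffun 'I_n -> X})
     (\prod_j p (x j)) * (tensor f b x * tensor f c x) = (b == c)%:R.
Proof.
move=> orth; under eq_bigr do rewrite -!big_split /=.
rewrite -(bigA_distr_bigA (fun j a => p a * (f (b j) a * f (c j) a))) /=.
have [<-|bc] := eqVneq b c.
  by rewrite big1 // => j _; rewrite orth eqxx.
have [j bcj] : exists j, b j != c j.
  apply/existsP; apply: contraNT bc; rewrite negb_exists => /forallP eq_bc.
  by apply/eqP/ffunP => j; apply/eqP/negPn/eq_bc.
by rewrite (bigD1 j) //= orth (negPf bcj) mul0r.
Qed.

(** The function of the [n] samples that accompanies [tensor f c] in the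
    likelihood ratio, once the latent injection is averaged out. *)
Definition averaged_tensor (R : realType) (X K : finType) (k0 : K)
    (f : K -> X -> R) (n m : nat) (c : {ffun 'I_m -> K}) (x : {ffun 'I_n -> X}) :
  R := \sum_(s in injections m n)
         (#|injections m n|%:R)^-1 * tensor f (transport k0 s c) x.

Definition likelihood_ratio (R : realType) (X K : finType) (k0 : K)
    (lam : K -> R) (f : K -> X -> R) (n m : nat)
    (x : {ffun 'I_n -> X}) (y : {ffun 'I_m -> X}) : R :=
  \sum_(c : {ffun 'I_m -> K})
    (\prod_i lam (c i)) * (averaged_tensor k0 f c x * tensor f c y).

(** Expand every factor [\sum_k lam k * (f k a * f k b)] of the likelihood
    ratio given [s]: a choice of one term per matched pair is a colouring [c] of
    the [m] samples. *)
Lemma planted_law_ratio (R : realType) (X K : finType) (P : X -> X -> R)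
    (p : X -> R) (k0 : K) (lam : K -> R) (f : K -> X -> R) (n m : nat)
    (x : {ffun 'I_n -> X}) (y : {ffun 'I_m -> X}) :
  diagonal_law P p k0 lam f ->
  planted_law P x y = product_weight p p x y * likelihood_ratio k0 lam f x y.
Proof.
move=> dP; have [orth f0 lam0 PE] := dP.
rewrite /planted_law /likelihood_ratio.
transitivity (\sum_(s in injections m n) (#|injections m n|%:R)^-1 *
  (product_weight p p x y * \sum_(c : {ffun 'I_m -> K})
    (\prod_i lam (c i)) * (tensor f (transport k0 s c) x * tensor f c y))).
  apply: eq_bigr => s /inj_injections s_inj; congr (_ * _).
  rewrite /planted_law_given; under eq_bigr do rewrite PE.
  rewrite 2!big_split /= (bigA_distr_bigA
    (fun i k => lam k * (f k (x (s i)) * f k (y i)))) /=.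
  have pE : \prod_j p (x j) =
      (\prod_i p (x (s i))) * \prod_(j | j \notin codom s) p (x j).
    by rewrite (bigID (mem (codom s))) /= big_codom.
  rewrite /product_weight pE.
  under [X in _ * X]eq_bigr do rewrite (diagonal_marginalX _ dP).
  have tE c : tensor f (transport k0 s c) x = \prod_i f (c i) (x (s i)).
    rewrite /tensor (bigID (mem (codom s))) /= big_codom //.
    rewrite [X in _ * X]big1 => [|j jNs]; last by rewrite transport_out.
    by rewrite mulr1; apply: eq_bigr => i _; rewrite transport_codom.
  have -> : \sum_(c : {ffun 'I_m -> K}) \prod_i
        (lam (c i) * (f (c i) (x (s i)) * f (c i) (y i))) =
      \sum_(c : {ffun 'I_m -> K}) (\prod_i lam (c i)) *
        (tensor f (transport k0 s c) x * tensor f c y).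
    by apply: eq_bigr => c _; rewrite tE !big_split.
  by ring.
under eq_bigr do rewrite mulrCA mulr_sumr.
rewrite -mulr_sumr exchange_big /=; congr (_ * _); apply: eq_bigr => c _.
rewrite /averaged_tensor mulr_suml mulr_sumr; apply: eq_bigr => s _; ring.
Qed.

(** By orthonormality only the diagonal terms survive, first in [y], which
    identifies the colourings, then in [x], which leaves the probability that
    two independent injections transport [c] to the same colouring. *)
Lemma likelihood_second_moment (R : realType) (X K : finType) (p : X -> R)
    (k0 : K) (lam : K -> R) (f : K -> X -> R) (n m : nat) :
  (forall k l, \sum_x p x * (f k x * f l x) = (k == l)%:R) ->
  \sum_(x : {ffun 'I_n -> X}) \sum_(y : {ffun 'I_m -> X})
     product_weight p p x y * likelihood_ratio k0 lam f x y ^+ 2 =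
  \sum_(c : {ffun 'I_m -> K}) (\prod_i lam (c i) ^+ 2) *
    (\sum_(s in injections m n)
        #|reaching k0 c (transport k0 s c)|%:R / #|injections m n|%:R ^+ 2).
Proof.
move=> orth.
transitivity (\sum_(x : {ffun 'I_n -> X}) (\prod_j p (x j)) *
  \sum_(c : {ffun 'I_m -> K})
    (\prod_i lam (c i) ^+ 2) * averaged_tensor k0 f c x ^+ 2).
  apply: eq_bigr => x _.
  pose A (c : {ffun 'I_m -> K}) := (\prod_i lam (c i)) * averaged_tensor k0 f c x.
  transitivity (\sum_(c : {ffun 'I_m -> K}) \sum_(c' : {ffun 'I_m -> K})
     (\prod_j p (x j)) * (A c * A c') * \sum_(y : {ffun 'I_m -> X})
        (\prod_i p (y i)) * (tensor f c y * tensor f c' y)).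
    under [LHS]eq_bigr do rewrite expr2 /likelihood_ratio mulr_suml mulr_sumr.
    rewrite exchange_big /=; apply: eq_bigr => c _.
    under eq_bigr do rewrite !mulr_sumr.
    rewrite exchange_big /=; apply: eq_bigr => c' _; rewrite mulr_sumr.
    by apply: eq_bigr => y _; rewrite /product_weight /A; ring.
  rewrite mulr_sumr; apply: eq_bigr => c _.
  rewrite (bigD1 c) //= [X in _ + X]big1 => [|c' /negPf c'c]; last first.
    by rewrite tensor_orthonormal // eq_sym c'c mulr0.
  by rewrite tensor_orthonormal // eqxx /A prodrXl /=; ring.
under eq_bigr do rewrite mulr_sumr.
rewrite exchange_big /=; apply: eq_bigr => c _.
transitivity ((\prod_i lam (c i) ^+ 2) *
   \sum_(s in injections m n) \sum_(s' in injections m n)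
    (#|injections m n|%:R ^- 2) *
   \sum_(x : {ffun 'I_n -> X}) (\prod_j p (x j)) *
     (tensor f (transport k0 s c) x * tensor f (transport k0 s' c) x)).
  transitivity ((\prod_i lam (c i) ^+ 2) * \sum_(x : {ffun 'I_n -> X})
    (\prod_j p (x j)) * averaged_tensor k0 f c x ^+ 2).
    by rewrite mulr_sumr; apply: eq_bigr => x _; ring.
  congr (_ * _); under eq_bigr do rewrite expr2 /averaged_tensor mulr_suml mulr_sumr.
  rewrite exchange_big /=; apply: eq_bigr => s _.
  under eq_bigr do rewrite !mulr_sumr.
  rewrite exchange_big /=; apply: eq_bigr => s' _; rewrite mulr_sumr.
  by apply: eq_bigr => x _; rewrite -exprVn; ring.
congr (_ * _); apply: eq_bigr => s _.
under eq_bigr do rewrite tensor_orthonormal //.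
rewrite -mulr_sumr mulrC; congr (_ / _).
rewrite -sum1_card natr_sum [in RHS]big_mkcond /= [LHS]big_mkcond /=.
apply: eq_bigr => s' _; rewrite in_reaching eq_sym.
by case: (s' \in _); case: eqP.
Qed.

Lemma prod_colours (R : realType) (K : finType) (m : nat) (g : K -> R)
    (c : {ffun 'I_m -> K}) :
  \prod_i g (c i) = \prod_k g k ^+ colour_count c k.
Proof.
rewrite (partition_big c predT) //=; apply: eq_bigr => k _.
rewrite /colour_count cardsE -prodr_const; apply: eq_big => [i|i /eqP ->] //.
Qed.

Lemma colour_count_le (K : finType) (m : nat) (c : {ffun 'I_m -> K}) (k : K) :
  (colour_count c k <= m)%N.
Proof. by rewrite -[leqRHS]card_ord max_card. Qed.

Lemma geometric_sum_le (R : realType) (u : R) (m : nat) :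
  0 <= u < 1 -> \sum_(e < m) u ^+ e <= (1 - u)^-1.
Proof.
move=> /andP[u0 u1]; rewrite -[leRHS]mul1r ler_pdivlMr ?subr_gt0 //.
by rewrite mulrC -opprB mulNr -subrX1 opprB lerBlDr lerDl exprn_ge0.
Qed.

(** Grouping the colourings by their colour counts [mu] leaves
    at most [prod_k (m / n * lam k ^+ 2) ^+ mu k], and the sum over all [mu] is a product
    of geometric sums. *)
Lemma likelihood_second_moment_le (R : realType) (X K : finType) (p : X -> R)
    (k0 : K) (lam : K -> R) (f : K -> X -> R) (n m : nat) :
  (m <= n)%N ->
  (forall k l, \sum_x p x * (f k x * f l x) = (k == l)%:R) ->
  lam k0 = 1 ->
  (forall k, k != k0 -> m%:R / n%:R * lam k ^+ 2 < 1) ->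
  \sum_(x : {ffun 'I_n -> X}) \sum_(y : {ffun 'I_m -> X})
     product_weight p p x y * likelihood_ratio k0 lam f x y ^+ 2 <=
  \prod_(k | k != k0) (1 - m%:R / n%:R * lam k ^+ 2)^-1.
Proof.
move=> mn orth lam0 lam_lt1; rewrite likelihood_second_moment //.
have [s0 s0_inj] := injections_exists mn.
have N_neq0 : #|injections m n|%:R != 0 :> R.
  by rewrite pnatr_eq0 -lt0n; apply/card_gt0P; exists s0.
pose w (c : {ffun 'I_m -> K}) : R :=
  #|reaching k0 c (transport k0 s0 c)|%:R / #|injections m n|%:R.
have w_ge0 c : 0 <= w c by apply: divr_ge0; exact: ler0n.
pose t : R := m%:R / n%:R.
have t_ge0 : 0 <= t by apply: divr_ge0; exact: ler0n.
(* Summed over all colour counts, [\prod_k G k (mu k)] factorizes; at [k0] it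
   keeps only [mu k0 = 0], where the type below leaves the count unrecorded. *)
pose G k e : R := if k == k0 then (e == 0%N)%:R else (t * lam k ^+ 2) ^+ e.
pose type (c : {ffun 'I_m -> K}) : {ffun K -> 'I_m.+1} :=
  [ffun k => if k == k0 then ord0 else inord (colour_count c k)].
have typeE c k : k != k0 -> type c k = colour_count c k :> nat.
  by move=> /negPf kk0; rewrite ffunE kk0 inordK // ltnS colour_count_le.
apply: (@le_trans _ _ (\sum_(c : {ffun 'I_m -> K}) (\prod_i lam (c i) ^+ 2) * w c)).
  rewrite le_eqVlt; apply/orP; left; apply/eqP; apply: eq_bigr => c _.
  congr (_ * _); rewrite (eq_bigr (fun=> w c / #|injections m n|%:R)).
    by rewrite sumr_const -[LHS]mulr_natr mulfVK.
  move=> s s_inj; rewrite /w expr2 invfM mulrA.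
  rewrite (@card_reaching_eq _ _ _ _ _ _ (transport k0 s0 c)) // => k kk0.
  by rewrite !colour_count_transport //; exact: inj_injections.
rewrite (partition_big type predT) //=.
apply: (@le_trans _ _ (\sum_(mu : {ffun K -> 'I_m.+1}) \prod_k G k (mu k))).
  apply: ler_sum => mu _; have [mu0|mu_neq0] := eqVneq (mu k0) ord0; last first.
    rewrite big1 => [|c /eqP type_c].
      apply: prodr_ge0 => k _; rewrite /G; case: eqP => _; first exact: ler0n.
      by apply/exprn_ge0/mulr_ge0 => //; exact: sqr_ge0.
    by move: mu_neq0; rewrite -type_c ffunE eqxx eqxx.
  rewrite [leRHS](_ : _ = (\prod_(k | k != k0) (lam k ^+ 2) ^+ mu k) *
      t ^+ (\sum_(k | k != k0) mu k)%N); last first.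
    rewrite (bigD1 k0) //= {1}/G eqxx mu0 eqxx mul1r.
    rewrite expr_sum -big_split /=; apply: eq_bigr => k /negPf kk0.
    by rewrite /G kk0 exprMn mulrC.
  have v_ge0 : 0 <= \prod_(k | k != k0) (lam k ^+ 2) ^+ mu k.
    by apply: prodr_ge0 => k _; apply/exprn_ge0/sqr_ge0.
  have := ler_wpM2l v_ge0 (sum_same_colours R k0 (fun k => mu k : nat) mn s0_inj).
  apply: le_trans.
  rewrite mulr_sumr big_mkcond [leRHS]big_mkcond /=; apply: ler_sum => c _.
  case: ifPn => [/eqP type_c|_]; last first.
    by case: ifP => // _; exact: mulr_ge0 v_ge0 (w_ge0 c).
  have col k : k != k0 -> colour_count c k = mu k.
    by move=> kk0; rewrite -type_c typeE.
  rewrite ifT; last by apply/forall_inP => k /col ->.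
  rewrite (prod_colours (fun k => lam k ^+ 2)) (bigD1 k0) //= lam0 !expr1n mul1r.
  by rewrite (eq_bigr _ (fun k kk0 => congr1 _ (col k kk0))).
rewrite -(bigA_distr_bigA (fun k (e : 'I_m.+1) => G k e)) (bigD1 k0) //=.
rewrite big_ord_recl {1}/G eqxx /= big1 ?addr0 ?mul1r => [|e _]; last first.
  by rewrite /G eqxx.
apply: ler_prod => k kk0; have u_ge0 : 0 <= t * lam k ^+ 2.
  by apply: mulr_ge0 => //; exact: sqr_ge0.
rewrite /G (negPf kk0) sumr_ge0 => [|e _]; last exact: exprn_ge0.
by apply: geometric_sum_le; rewrite u_ge0 lam_lt1.
Qed.

(** * From the two laws to the errors of a test *)

Lemma event_prob_split (R : realType) (A B : finType) (L : A -> B -> R)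
    (E : A -> B -> bool) :
  event_prob L E + event_prob L (fun a b => ~~ E a b) = \sum_a \sum_b L a b.
Proof.
rewrite /event_prob -big_split /=; apply: eq_bigr => a _.
by rewrite [RHS](bigID (E a)).
Qed.

Lemma event_prob_le (R : realType) (A B : finType) (L L' : A -> B -> R)
    (E E' : A -> B -> bool) :
  (forall a b, E a b -> L a b <= L' a b) -> (forall a b, 0 <= L' a b) ->
  (forall a b, E a b -> E' a b) -> event_prob L E <= event_prob L' E'.
Proof.
move=> LL' L'0 EE'; apply: ler_sum => a _; rewrite big_mkcond [leRHS]big_mkcond /=.
apply: ler_sum => b _; case: ifPn => [Eab|_]; first by rewrite EE' // LL'.
by case: ifP.
Qed.

(** A bounded second moment of the likelihood ratio [r] keeps the errors away
    from [0]: pointwise [r <= r ^+ 2 / (2 * C) + C / 2], so the rejection region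
    carries at most [1 / 2 + C / 2 * event_prob w E] of the mass of [w * r]. *)
Lemma second_moment_errors (R : realType) (A B : finType) (w r : A -> B -> R)
    (C : R) (E : A -> B -> bool) :
  0 < C -> (forall a b, 0 <= w a b) ->
  \sum_a \sum_b w a b * r a b = 1 -> \sum_a \sum_b w a b * r a b ^+ 2 <= C ->
  1 / 2 <= event_prob (fun a b => w a b * r a b) (fun a b => ~~ E a b) +
           C / 2 * event_prob w E.
Proof.
move=> C0 w0 mass1 moment.
have iC : 0 <= (2 * C)^-1 by rewrite invr_ge0 mulr_ge0 // ltW.
have hC : 0 <= C / 2 by rewrite divr_ge0 // ltW.
have := event_prob_split (fun a b => w a b * r a b) E; rewrite mass1 => split1.
have : event_prob (fun a b => w a b * r a b) E <=
    (2 * C)^-1 * \sum_a \sum_b w a b * r a b ^+ 2 + C / 2 * event_prob w E.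
  apply: (@le_trans _ _ (event_prob
    (fun a b => (2 * C)^-1 * (w a b * r a b ^+ 2) + C / 2 * w a b) E)).
    apply: event_prob_le => // a b; last first.
      by rewrite addr_ge0 // mulr_ge0 // mulr_ge0 // sqr_ge0.
    move=> _; rewrite -subr_ge0.
    rewrite (_ : _ - _ = w a b * ((2 * C)^-1 * (r a b - C) ^+ 2)).
      by rewrite mulr_ge0 // mulr_ge0 // sqr_ge0.
    by field; rewrite gt_eqF.
  rewrite /event_prob !mulr_sumr -big_split /=; apply: ler_sum => a _.
  rewrite big_split /= -!mulr_sumr lerD2r ler_wpM2l //.
  rewrite [leRHS](bigID (E a)) /= lerDl sumr_ge0 // => b _.
  by rewrite mulr_ge0 // sqr_ge0.
have : (2 * C)^-1 * \sum_a \sum_b w a b * r a b ^+ 2 <= 1 / 2.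
  rewrite (_ : 1 / 2 = (2 * C)^-1 * C); last by field; rewrite gt_eqF.
  exact: ler_wpM2l.
lra.
Qed.

Lemma planted_law_given_mass (R : realType) (X Y : finType) (P : X -> Y -> R)
    (n m : nat) (s : {ffun 'I_m -> 'I_n}) :
  injective s -> \sum_a \sum_b P a b = 1 ->
  \sum_x \sum_y planted_law_given P s x y = 1.
Proof.
move=> s_inj mass1.
rewrite (sum_coupled (fun=> P) (fun=> marginalX P) s_inj).
by rewrite [X in X * _]big1 // [X in _ * X]big1 // mulr1.
Qed.

Lemma planted_law_mix (R : realType) (X Y : finType) (P : X -> Y -> R)
    (n m : nat) (F : {ffun 'I_n -> X} -> {ffun 'I_m -> Y} -> R) :
  \sum_x \sum_y planted_law P x y * F x y =
  \sum_(s in injections m n) (#|injections m n|%:R)^-1 *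
    \sum_x \sum_y planted_law_given P s x y * F x y.
Proof.
under eq_bigr do under eq_bigr do rewrite /planted_law mulr_suml.
under eq_bigr do rewrite exchange_big /=.
rewrite exchange_big /=; apply: eq_bigr => s _; rewrite mulr_sumr.
by apply: eq_bigr => x _; rewrite mulr_sumr; apply: eq_bigr => y _; rewrite -mulrA.
Qed.

Lemma mean_injections_ge (R : realType) (m n : nat)
    (F : {ffun 'I_m -> 'I_n} -> R) (c : R) :
  (m <= n)%N -> (forall s : {ffun 'I_m -> 'I_n}, injective s -> c <= F s) ->
  c <= \sum_(s in injections m n) (#|injections m n|%:R)^-1 * F s.
Proof.
move=> /injections_exists[s0 s0_inj] cF.
have N_neq0 : #|injections m n|%:R != 0 :> R.
  by rewrite pnatr_eq0 -lt0n; apply/card_gt0P; exists s0.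
rewrite -mulr_sumr -[c](mulKf N_neq0); apply: ler_wpM2l.
  by rewrite invr_ge0 ler0n.
rewrite mulr_natl -sumr_const; apply: ler_sum => s /inj_injections; exact: cF.
Qed.

Lemma mean_injections_le (R : realType) (m n : nat)
    (F : {ffun 'I_m -> 'I_n} -> R) (c : R) :
  (m <= n)%N -> (forall s : {ffun 'I_m -> 'I_n}, injective s -> F s <= c) ->
  \sum_(s in injections m n) (#|injections m n|%:R)^-1 * F s <= c.
Proof.
move=> mn Fc; rewrite -lerN2 -sumrN.
under eq_bigr do rewrite -mulrN.
by apply: mean_injections_ge => // s s_inj; rewrite lerN2 Fc.
Qed.

Lemma planted_law_mass (R : realType) (X Y : finType) (P : X -> Y -> R)
    (n m : nat) :
  (m <= n)%N -> \sum_a \sum_b P a b = 1 ->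
  \sum_(x : {ffun 'I_n -> X}) \sum_(y : {ffun 'I_m -> Y}) planted_law P x y = 1.
Proof.
move=> mn mass1.
transitivity (\sum_(s in injections m n) (#|injections m n|%:R)^-1 * (1 : R)).
  under eq_bigr do under eq_bigr do rewrite -[planted_law _ _ _]mulr1.
  rewrite planted_law_mix; apply: eq_bigr => s /inj_injections s_inj.
  congr (_ * _); under eq_bigr do under eq_bigr do rewrite mulr1.
  exact: planted_law_given_mass.
by apply/eqP; rewrite eq_le mean_injections_le ?mean_injections_ge.
Qed.

Lemma type2_errorE (R : realType) (X Y : finType) (P : X -> Y -> R) (n m : nat)
    (phi : {ffun 'I_n -> X} -> {ffun 'I_m -> Y} -> bool) :
  type2_error P phi = \sum_(s in injections m n) (#|injections m n|%:R)^-1 *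
    event_prob (planted_law_given P s) (fun x y => ~~ phi x y).
Proof.
rewrite /type2_error /event_prob.
under eq_bigr do rewrite exchange_big /=.
rewrite exchange_big /=; apply: eq_bigr => s _; rewrite mulr_sumr.
by apply: eq_bigr => x _; rewrite mulr_sumr.
Qed.

Lemma null_law_coupled (R : realType) (X Y : finType) (P : X -> Y -> R)
    (n m : nat) (s : {ffun 'I_m -> 'I_n})
    (x : {ffun 'I_n -> X}) (y : {ffun 'I_m -> Y}) :
  injective s ->
  null_law P x y = (\prod_i (marginalX P (x (s i)) * marginalY P (y i))) *
                   \prod_(j < n | j \notin codom s) marginalX P (x j).
Proof.
move=> s_inj; rewrite /null_law (bigID (mem (codom s))) /= big_codom //.
by rewrite mulrAC -big_split.
Qed.

(** The sum of the errors is an average over the matching [s], and for given [s]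
    both laws dominate the measure that couples the matched samples through
    [M], whichever hypothesis the test accepts. *)
Lemma errors_ge_minorant (R : realType) (X Y : finType) (P M : X -> Y -> R)
    (n m : nat) (phi : {ffun 'I_n -> X} -> {ffun 'I_m -> Y} -> bool) :
  (m <= n)%N -> (forall a b, 0 <= P a b) -> \sum_a \sum_b P a b = 1 ->
  (forall a b, 0 <= M a b <= P a b) ->
  (forall a b, M a b <= marginalX P a * marginalY P b) ->
  (\sum_a \sum_b M a b) ^+ m <= type1_error P phi + type2_error P phi.
Proof.
move=> mn P0 mass1 MP Mnull; rewrite -lerBlDl type2_errorE.
apply: mean_injections_ge => // s s_inj; rewrite lerBlDl.
have mX0 a : 0 <= marginalX P a by apply: sumr_ge0.
have -> : (\sum_a \sum_b M a b) ^+ m =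
    \sum_(x : {ffun 'I_n -> X}) \sum_(y : {ffun 'I_m -> Y})
     (\prod_(i < m) M (x (s i)) (y i)) *
     (\prod_(j < n | j \notin codom s) marginalX P (x j)).
  rewrite (sum_coupled (fun=> M) (fun=> marginalX P) s_inj).
  by rewrite prodr_const card_ord [X in _ * X]big1 ?mulr1.
rewrite /type1_error /event_prob -big_split; apply: ler_sum => x _ /=.
rewrite [leLHS](bigID (phi x)) /=; apply: lerD; apply: ler_sum => y _.
  rewrite (null_law_coupled _ _ _ s_inj).
  apply: ler_wpM2r; first exact: prodr_ge0.
  by apply: ler_prod => i _; rewrite Mnull; case/andP: (MP (x (s i)) (y i)) => ->.
by apply: ler_wpM2r; [exact: prodr_ge0 | apply: ler_prod => i _].
Qed.

(** * The Bernoulli kernel and its Walsh basis *)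

Lemma iid_pair_marginalX (R : realType) (p : bool -> bool -> R) (d : nat)
    (u : {ffun 'I_d -> bool}) :
  marginalX (@iid_pair R p d) u = \prod_k marginalX p (u k).
Proof.
by rewrite /marginalX /iid_pair -(bigA_distr_bigA (fun k b => p (u k) b)).
Qed.

Lemma iid_pair_marginalY (R : realType) (p : bool -> bool -> R) (d : nat)
    (v : {ffun 'I_d -> bool}) :
  marginalY (@iid_pair R p d) v = \prod_k marginalY p (v k).
Proof.
by rewrite /marginalY /iid_pair -(bigA_distr_bigA (fun k a => p a (v k))).
Qed.

Lemma sum_iid_pair (R : realType) (d : nat) (p : 'I_d -> bool -> bool -> R) :
  \sum_(u : {ffun 'I_d -> bool}) \sum_(v : {ffun 'I_d -> bool})
    \prod_k p k (u k) (v k) = \prod_k \sum_a \sum_b p k a b.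
Proof.
rewrite bigA_distr_bigA; apply: eq_bigr => u _.
by rewrite -(bigA_distr_bigA (fun k b => p k (u k) b)).
Qed.

Definition bernoulli (R : realType) (q : R) (b : bool) : R :=
  if b then q else 1 - q.

Lemma bernoulli_pair_marginalX (R : realType) (q rho : R) (b : bool) :
  marginalX (bernoulli_pair q rho) b = bernoulli q b.
Proof. by rewrite /marginalX big_bool; case: b => /=; ring. Qed.

Lemma bernoulli_pair_marginalY (R : realType) (q rho : R) (b : bool) :
  marginalY (bernoulli_pair q rho) b = bernoulli q b.
Proof. by rewrite /marginalY big_bool; case: b => /=; ring. Qed.

Lemma bernoulli_pair_mass (R : realType) (q rho : R) :
  \sum_a \sum_b bernoulli_pair q rho a b = 1.
Proof. by rewrite !big_bool /=; ring. Qed.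

Lemma bernoulli_pair_ge0 (R : realType) (q rho : R) (a b : bool) :
  0 < q <= 1 / 2 -> - (q / (1 - q)) <= rho <= 1 -> 0 <= bernoulli_pair q rho a b.
Proof.
move=> /andP[q0 q2] /andP[rho_ge rho1].
have q1 : 0 < 1 - q by lra.
have rq : 0 <= q + rho * (1 - q).
  by move: rho_ge; rewrite -mulNr ler_pdivrMr //; lra.
case: a; case: b => /=; apply: mulr_ge0; try nra.
Qed.

Lemma iid_pair_ge0 (R : realType) (p : bool -> bool -> R) (d : nat)
    (u v : {ffun 'I_d -> bool}) :
  (forall a b, 0 <= p a b) -> 0 <= iid_pair p u v.
Proof. by move=> p0; apply: prodr_ge0. Qed.

Lemma iid_pair_mass (R : realType) (p : bool -> bool -> R) (d : nat) :
  \sum_a \sum_b p a b = 1 ->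
  \sum_(u : {ffun 'I_d -> bool}) \sum_(v : {ffun 'I_d -> bool}) iid_pair p u v = 1.
Proof. by move=> p1; rewrite (sum_iid_pair (fun=> p)) big1. Qed.

(** The eigenfunction of one coordinate for the eigenvalue [rho]; the other one
    is the constant. *)
Definition standardized (R : realType) (q : R) (b : bool) : R :=
  (b%:R - q) / Num.sqrt (q * (1 - q)).

(** Eigenfunctions of the [d]-fold product, for the eigenvalue
    [rho ^+ #|S|]. *)
Definition walsh (R : realType) (q : R) (d : nat) (S : {set 'I_d})
    (u : {ffun 'I_d -> bool}) : R :=
  \prod_k (if k \in S then standardized q (u k) else 1).

(** In one coordinate the likelihood ratio is [1 + rho * phi a * phi b] with
    [phi] standardized; expanding the product over the coordinates gives one
    term for each set [S] of coordinates. *)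
Lemma iid_bernoulli_diagonal (R : realType) (q rho : R) (d : nat) :
  0 < q <= 1 / 2 ->
  diagonal_law (@iid_pair R (bernoulli_pair q rho) d)
    (fun u => \prod_k bernoulli q (u k)) (finset.set0 : {set 'I_d})
    (fun S : {set 'I_d} => rho ^+ #|S|) (@walsh R q d).
Proof.
move=> /andP[q0 q2]; have v0 : 0 < q * (1 - q) by nra.
have sv0 : Num.sqrt (q * (1 - q)) != 0 by rewrite gt_eqF // sqrtr_gt0.
have sv2 : Num.sqrt (q * (1 - q)) ^+ 2 = q * (1 - q) by rewrite sqr_sqrtr // ltW.
have q1 : 1 - q != 0 by rewrite gt_eqF //; lra.
have q0' : q != 0 by rewrite gt_eqF.
split.
- move=> S T; rewrite /walsh.
  under eq_bigr do rewrite -!big_split /=.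
  rewrite -(bigA_distr_bigA (fun k b => bernoulli q b *
    ((if k \in S then standardized q b else 1) *
     (if k \in T then standardized q b else 1)))) /=.
  have E k : \sum_b bernoulli q b * ((if k \in S then standardized q b else 1) *
     (if k \in T then standardized q b else 1)) = ((k \in S) == (k \in T))%:R.
    rewrite big_bool /bernoulli /standardized.
    case: (k \in S); case: (k \in T) => /=.
    + (* Multiplying by the variance leaves only its square root to cancel. *)
      rewrite -[1 *+ true]/(1 : R) -[1 *+ false]/(0 : R).
      apply: (mulfI (x := Num.sqrt (q * (1 - q)) ^+ 2)); first by rewrite expf_neq0.
      rewrite [RHS]mulr1 [RHS]sv2; field; exact: sv0.
    + by rewrite -[1 *+ true]/(1 : R) -[1 *+ false]/(0 : R); field.
    + by rewrite -[1 *+ true]/(1 : R) -[1 *+ false]/(0 : R); field.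
    + by rewrite -[1 *+ true]/(1 : R); ring.
  under eq_bigr do rewrite E.
  have [<-|ST] := eqVneq S T; first by rewrite big1 // => k _; rewrite eqxx.
  have [k kST] : exists k, (k \in S) != (k \in T).
    apply/existsP; apply: contraNT ST; rewrite negb_exists => /forallP eq_ST.
    by apply/eqP/setP => k; apply/eqP/negPn/eq_ST.
  by rewrite (bigD1 k) //= (negPf kST) mul0r.
- by move=> u; rewrite /walsh big1 // => k _; rewrite finset.in_set0.
- by rewrite cards0 expr0.
move=> u v; rewrite -big_split /=.
transitivity (\prod_k ((bernoulli q (u k) * bernoulli q (v k)) *
   (rho * (standardized q (u k) * standardized q (v k)) + 1))).
  apply: eq_bigr => k _.
  have -> : standardized q (u k) * standardized q (v k) =
      ((u k)%:R - q) * ((v k)%:R - q) / (q * (1 - q)).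
    by rewrite /standardized mulf_div -expr2 sv2.
  rewrite /bernoulli; case: (u k); case: (v k) => /=;
    by field; rewrite q0' q1.
rewrite big_split /=; congr (_ * _).
rewrite (bigA_distr 1 +%R (fun k => rho * (standardized q (u k) * standardized q (v k)))
  (fun=> 1)) /=; apply: eq_big => [S|S _]; first by rewrite inE.
rewrite /walsh -prodr_const [X in X * _]big_mkcond -!big_split /=.
by apply: eq_bigr => k _; case: ifP => _; ring.
Qed.

Lemma sum_sets_exp (R : realType) (d : nat) (a : R) :
  \sum_(S : {set 'I_d}) a ^+ #|S| = (a + 1) ^+ d.
Proof.
rewrite -[d in RHS]card_ord -prodr_const (bigA_distr 1 +%R (fun=> a) (fun=> 1)) /=.
apply: eq_big => [S|S _]; first by rewrite inE.
by rewrite -prodr_const big_mkcond.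
Qed.

(** * Impossibility bounds at a fixed sample size *)

Lemma iid_bernoulli_second_moment_errors (R : realType) (q rho : R)
    (d n m : nat) (C : R)
    (phi : {ffun 'I_n -> {ffun 'I_d -> bool}} ->
           {ffun 'I_m -> {ffun 'I_d -> bool}} -> bool) :
  0 < q <= 1 / 2 -> (m <= n)%N -> 0 < C ->
  (forall S : {set 'I_d}, S != finset.set0 ->
     m%:R / n%:R * (rho ^+ #|S|) ^+ 2 < 1) ->
  \prod_(S : {set 'I_d} | S != finset.set0)
     (1 - m%:R / n%:R * (rho ^+ #|S|) ^+ 2)^-1 <= C ->
  1 / 2 <= type2_error (@iid_pair R (bernoulli_pair q rho) d) phi +
           C / 2 * type1_error (@iid_pair R (bernoulli_pair q rho) d) phi.
Proof.
move=> hq mn C0 lt1 leC; have dP := iid_bernoulli_diagonal rho d hq.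
have [orth _ lam0 _] := dP.
pose p (u : {ffun 'I_d -> bool}) := \prod_k bernoulli q (u k).
pose w := @product_weight R _ _ p p n m.
pose r := likelihood_ratio (finset.set0 : {set 'I_d})
  (fun S : {set 'I_d} => rho ^+ #|S|) (@walsh R q d) (n := n) (m := m).
have plantedE x y : planted_law (@iid_pair R (bernoulli_pair q rho) d) x y =
    w x y * r x y by apply: planted_law_ratio dP.
have w0 x y : 0 <= w x y.
  have p0 u : 0 <= p u.
    apply: prodr_ge0 => k _; move: hq => /andP[q0 q2].
    by rewrite /bernoulli; case: (u k); lra.
  by apply: mulr_ge0; apply: prodr_ge0.
have := second_moment_errors phi C0 w0 (r := r).
rewrite /type2_error /type1_error /event_prob.
under [X in _ -> _ <= X + _]eq_bigr do under eq_bigr do rewrite plantedE.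
under [X in _ -> _ <= _ + _ * X]eq_bigr do under eq_bigr do
  rewrite (diagonal_null_law _ _ dP).
apply.
  rewrite -(planted_law_mass mn (iid_pair_mass d (bernoulli_pair_mass q rho))).
  by apply: eq_bigr => x _; apply: eq_bigr => y _; rewrite plantedE.
apply: le_trans leC; exact: likelihood_second_moment_le.
Qed.

(** Each of the four cells of [bernoulli_pair q rho] differs by exactly
    [q * (1 - q) * `|rho|] from independence, so the overlap of the two laws of a
    coordinate is [1 - 2 * (q * (1 - q)) * `|rho|]; overlaps multiply over the
    [d * m] matched coordinates. *)
Lemma iid_bernoulli_errors_ge (R : realType) (q rho : R) (d n m : nat)
    (phi : {ffun 'I_n -> {ffun 'I_d -> bool}} ->
           {ffun 'I_m -> {ffun 'I_d -> bool}} -> bool) :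
  0 < q <= 1 / 2 -> - (q / (1 - q)) <= rho <= 1 -> (m <= n)%N ->
  (1 - 2 * (q * (1 - q)) * `|rho|) ^+ (d * m) <=
  type1_error (@iid_pair R (bernoulli_pair q rho) d) phi +
  type2_error (@iid_pair R (bernoulli_pair q rho) d) phi.
Proof.
move=> hq hrho mn.
have b0 a b := bernoulli_pair_ge0 a b hq hrho.
pose mu a b : R := Num.min (bernoulli_pair q rho a b) (bernoulli q a * bernoulli q b).
have mu0 a b : 0 <= mu a b.
  rewrite le_min b0 /= /bernoulli; move: hq => /andP[q0 q2].
  by case: a; case: b; apply: mulr_ge0; lra.
have sum_mu : \sum_a \sum_b mu a b = 1 - 2 * (q * (1 - q)) * `|rho|.
  have v0 : 0 <= q * (1 - q) by move: hq => /andP[]; nra.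
  have muE a b : mu a b = (bernoulli_pair q rho a b + bernoulli q a * bernoulli q b
                           - q * (1 - q) * `|rho|) / 2.
    rewrite /mu minr_absE; congr ((_ - _) / _).
    rewrite -[X in _ = X * _](ger0_norm v0) -normrM.
    case: a; case: b; rewrite /bernoulli /=; first [congr (`| _ |); ring
      | rewrite -normrN; congr (`| _ |); ring].
  by rewrite !big_bool !muE /=; field.
rewrite -sum_mu exprM.
have -> : (\sum_a \sum_b mu a b) ^+ d = \sum_(u : {ffun 'I_d -> bool})
    \sum_(v : {ffun 'I_d -> bool}) iid_pair mu u v.
  by rewrite (sum_iid_pair (fun=> mu)) prodr_const card_ord.
apply: errors_ge_minorant => //.
- by move=> u v; exact: iid_pair_ge0.
- exact/iid_pair_mass/bernoulli_pair_mass.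
- move=> u v; rewrite iid_pair_ge0 //=; apply: ler_prod => k _.
  by rewrite mu0 ge_min lexx.
move=> u v; rewrite iid_pair_marginalX iid_pair_marginalY -big_split /=.
apply: ler_prod => k _; rewrite mu0 /=.
by rewrite bernoulli_pair_marginalX bernoulli_pair_marginalY ge_min lexx orbT.
Qed.

Lemma expr_sqr_le (R : realType) (rho : R) (k : nat) :
  `|rho| <= 1 -> (0 < k)%N -> (rho ^+ k) ^+ 2 <= rho ^+ 2.
Proof.
move=> rho1 k0; rewrite exprAC -[leRHS]expr1 ler_wiXn2l ?sqr_ge0 //.
by rewrite -real_normK ?num_real // expr_le1.
Qed.

Lemma second_moment_bound_fixed (R : realType) (t rho eps : R) (d : nat) :
  0 <= t -> `|rho| <= 1 -> 0 < eps -> t * rho ^+ 2 <= 1 - eps ->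
  \prod_(S : {set 'I_d} | S != finset.set0) (1 - t * (rho ^+ #|S|) ^+ 2)^-1
  <= eps^-1 ^+ #|[pred S : {set 'I_d} | S != finset.set0]|.
Proof.
move=> t0 rho1 eps0 le_eps; rewrite -prodr_const; apply: ler_prod => S S0.
have : t * (rho ^+ #|S|) ^+ 2 <= 1 - eps.
  apply: le_trans le_eps; apply: ler_wpM2l => //.
  by apply: expr_sqr_le => //; rewrite card_gt0.
move=> leS; have epsS : eps <= 1 - t * (rho ^+ #|S|) ^+ 2 by lra.
have S_gt0 := lt_le_trans eps0 epsS.
by rewrite invr_ge0 ltW //= lef_pV2 ?posrE.
Qed.

(** [(1 - t * v)^-1 <= expR (2 * v)] for [v <= 1 / 2], and the squared
    eigenvalues, with that of the constant, sum to
    [(1 + rho ^+ 2) ^+ d <= expR (rho ^+ 2 * d)]. *)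
Lemma second_moment_bound_large (R : realType) (t rho : R) (d : nat) :
  0 <= t <= 1 -> rho ^+ 2 <= 1 / 2 ->
  \prod_(S : {set 'I_d} | S != finset.set0) (1 - t * (rho ^+ #|S|) ^+ 2)^-1
  <= expR (2 * expR (rho ^+ 2 * d%:R)).
Proof.
move=> /andP[t0 t1] rho2.
have rho1 : `|rho| <= 1.
  rewrite -(@expr_le1 _ 2) // real_normK ?num_real //; lra.
apply: (@le_trans _ _ (\prod_(S : {set 'I_d} | S != finset.set0)
    expR (2 * (rho ^+ 2) ^+ #|S|))).
  apply: ler_prod => S S0; rewrite [(rho ^+ 2) ^+ _]exprAC.
  have := expr_sqr_le (k := #|S|) rho1; rewrite card_gt0 => /(_ S0) leS.
  have S_ge0 : 0 <= (rho ^+ #|S|) ^+ 2 by exact: sqr_ge0.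
  set v := (_ ^+ #|S|) ^+ 2 in leS S_ge0 *.
  have tv : t * v <= v by rewrite ler_piMl.
  have tv0 : 0 <= t * v by exact: mulr_ge0.
  rewrite invr_ge0; apply/andP; split; first by lra.
  apply: le_trans (expR_ge1Dx _).
  rewrite -[leLHS]mul1r ler_pdivrMr; last lra.
  nra.
rewrite -expR_sum ler_expR -mulr_sumr ler_wpM2l //.
apply: (@le_trans _ _ (\sum_(S : {set 'I_d}) (rho ^+ 2) ^+ #|S|)).
  rewrite [leRHS](bigID (fun S => S != finset.set0)) /= lerDl.
  by apply: sumr_ge0 => S _; apply/exprn_ge0/sqr_ge0.
rewrite sum_sets_exp [rho ^+ 2 * _]mulrC expRM_natl.
by apply: lerXn2r; rewrite ?nnegrE ?addr_ge0 ?sqr_ge0 ?expR_ge0 // addrC expR_ge1Dx.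
Qed.

(** * Necessity of the conditions *)

Lemma correlation_bounds (R : realType) (q rho : R) :
  0 < q <= 1 / 2 ->
  - Num.min (q / (1 - q)) ((1 - q) / q) <= rho <= 1 ->
  - (q / (1 - q)) <= rho <= 1 /\ `|rho| <= 1.
Proof.
move=> /andP[q0 q2] /andP[rho_ge rho1].
have q1 : 0 < 1 - q by lra.
have rho_ge' : - (q / (1 - q)) <= rho.
  by apply: le_trans rho_ge; rewrite lerN2 ge_min lexx.
have qq : q / (1 - q) <= 1 by rewrite ler_pdivrMr //; lra.
by rewrite rho_ge' rho1 ler_norml rho1 andbT; split => //; lra.
Qed.

Lemma sample_size_le (R : realType) (alpha : R) (n : nat) :
  0 < alpha <= 1 ->
  [/\ (Num.truncn (alpha * n%:R)%R <= n)%N &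
      0 <= ((Num.truncn (alpha * n%:R))%:R / n%:R : R) <= alpha].
Proof.
move=> /andP[a0 a1].
have mle : (Num.truncn (alpha * n%:R))%:R <= alpha * n%:R.
  by rewrite truncn_le mulr_ge0 // ltW.
split.
  by rewrite -(ler_nat R) (le_trans mle) // ler_piMl.
rewrite divr_ge0 //=; have [->|n0] := posnP n.
  by rewrite invr0 mulr0 ltW.
by rewrite ler_pdivrMr // ltr0n.
Qed.

Lemma detection_errors (R : realType) (X Y : nat -> finType)
    (P : forall n, X n -> Y n -> R) (m : nat -> nat) (eps : R) :
  strong_detection P m -> 0 < eps ->
  \forall n \near \oo, exists phi : {ffun 'I_n -> X n} -> {ffun 'I_(m n) -> Y n} -> bool,
    type1_error (P n) phi < eps /\ type2_error (P n) phi < eps.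
Proof.
move=> [phi [t1 t2]] eps0.
have {}t1 := (@cvgr0Pnorm_lt _ _ _ _ eventually_filter _).1 t1 _ eps0.
have {}t2 := (@cvgr0Pnorm_lt _ _ _ _ eventually_filter _).1 t2 _ eps0.
apply: filterS2 t1 t2 => n t1 t2; exists (phi n).
by split; apply: le_lt_trans (ler_norm _) _.
Qed.

Lemma detection_second_moment (R : realType) (alpha : R) (q rho : nat -> R)
    (d : nat -> nat) (C : R) :
  0 < alpha <= 1 -> (forall n, 0 < q n <= 1 / 2) ->
  bernoulli_strong_detection alpha q rho d -> 0 < C ->
  let t n : R := (Num.truncn (alpha * n%:R))%:R / n%:R in
  \forall n \near \oo,
    (forall S : {set 'I_(d n)}, S != finset.set0 ->
       t n * (rho n ^+ #|S|) ^+ 2 < 1) ->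
    C < \prod_(S : {set 'I_(d n)} | S != finset.set0)
          (1 - t n * (rho n ^+ #|S|) ^+ 2)^-1.
Proof.
move=> halpha hq detect C0 t.
have e1 : 0 < 1 / 4 :> R by lra.
have e2 : 0 < (2 * C)^-1 by rewrite invr_gt0; lra.
have err1 := detection_errors detect (eps := Num.min (1 / 4) (2 * C)^-1).
rewrite lt_min e1 e2 /= in err1.
apply: filterS (err1 isT) => n [phi [T1 T2]] lt1.
rewrite ltNge; apply/negP => leC; move: T1 T2.
rewrite !lt_min => /andP[_ T1] /andP[T2 _].
have [mn _] := sample_size_le n halpha.
have := iid_bernoulli_second_moment_errors phi (hq n) mn C0 lt1 leC.
have : C / 2 * type1_error (@iid_pair R (bernoulli_pair (q n) (rho n)) (d n)) phi
    < 1 / 4.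
  rewrite (_ : 1 / 4 = C / 2 * (2 * C)^-1) ?ltr_pM2l //; first lra.
  by field; rewrite gt_eqF.
lra.
Qed.

Lemma detection_fixed_correlation (R : realType) (alpha : R) (q rho : nat -> R)
    (d : nat) :
  0 < alpha <= 1 -> (forall n, 0 < q n <= 1 / 2) -> (forall n, `|rho n| <= 1) ->
  bernoulli_strong_detection alpha q rho (fun=> d) ->
  forall eps : R, 0 < eps -> \forall n \near \oo, 1 - eps < alpha * rho n ^+ 2.
Proof.
move=> halpha hq hrho detect eps eps0.
pose C : R := eps^-1 ^+ #|[pred S : {set 'I_d} | S != finset.set0]|.
have C0 : 0 < C by rewrite exprn_gt0 // invr_gt0.
have big := detection_second_moment halpha hq detect C0.
apply: filterS big => n big; rewrite ltNge; apply/negP => le_eps.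
have [_ /andP[t0 ta]] := sample_size_le n halpha.
set t := (X in X <= alpha) in t0 ta.
have tS k : (0 < k)%N -> t * (rho n ^+ k) ^+ 2 <= 1 - eps.
  move=> k0; apply: le_trans le_eps; apply: ler_pM => //; first exact: sqr_ge0.
  exact: expr_sqr_le.
have : C < \prod_(S : {set 'I_d} | S != finset.set0)
          (1 - t * (rho n ^+ #|S|) ^+ 2)^-1.
  have : forall S : {set 'I_d}, S != finset.set0 -> t * (rho n ^+ #|S|) ^+ 2 < 1.
    move=> S S0; apply: le_lt_trans (tS _ _) _; rewrite ?card_gt0 //; lra.
  exact: big.
apply/negP; rewrite -leNgt; apply: second_moment_bound_fixed => //.
by have := tS 1%N isT; rewrite expr1.
Qed.

Lemma detection_large_correlation (R : realType) (alpha : R) (q rho : nat -> R)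
    (d : nat -> nat) :
  0 < alpha <= 1 -> (forall n, 0 < q n <= 1 / 2) -> (d n @[n --> \oo] --> \oo) ->
  bernoulli_strong_detection alpha q rho d ->
  rho n ^+ 2 * (d n)%:R @[n --> \oo] --> +oo.
Proof.
move=> halpha hq dn detect; apply/cvgryPge => A.
pose C : R := expR (2 * expR A).
have big := detection_second_moment halpha hq detect (expR_gt0 (2 * expR A)).
have {}dn := (@cvgnyPge _ _ eventually_filter _).1 dn (Num.truncn (2 * A)).+1.
apply: filterS2 big dn => n big dn; rewrite leNgt; apply/negP => lt_A.
have dA : 2 * A <= (d n)%:R.
  apply: ltW; apply: lt_le_trans (_ : (Num.truncn (2 * A)).+1%:R <= _).
    have [A0|A0] := lerP 0 (2 * A); first by case/andP: (truncn_itv A0).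
    exact: lt_le_trans A0 (ler0n _ _).
  by rewrite ler_nat.
have d1 : 1 <= (d n)%:R :> R.
  by rewrite ler1n; exact: leq_trans dn.
have rho2 : rho n ^+ 2 <= 1 / 2.
  have := sqr_ge0 (rho n); nra.
have [_ /andP[t0 ta]] := sample_size_le n halpha.
set t := (X in X <= alpha) in t0 ta.
have t1 : t <= 1 by apply: le_trans ta _; case/andP: halpha.
have rho1 : `|rho n| <= 1.
  rewrite -(@expr_le1 _ 2) // real_normK ?num_real //; lra.
have : C < \prod_(S : {set 'I_(d n)} | S != finset.set0)
          (1 - t * (rho n ^+ #|S|) ^+ 2)^-1.
  have : forall S : {set 'I_(d n)}, S != finset.set0 -> t * (rho n ^+ #|S|) ^+ 2 < 1.
    move=> S S0; have := expr_sqr_le (k := #|S|) rho1; rewrite card_gt0 => /(_ S0).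
    by have := sqr_ge0 (rho n ^+ #|S|); nra.
  exact: big.
apply/negP; rewrite -leNgt; apply: le_trans (second_moment_bound_large _ _ _) _.
- by rewrite t0.
- by [].
by rewrite ler_expR ler_wpM2l // ler_expR ltW.
Qed.

Lemma detection_signal (R : realType) (alpha : R) (q rho : nat -> R)
    (d : nat -> nat) :
  0 < alpha <= 1 -> (forall n, 0 < q n <= 1 / 2) ->
  (forall n, - (q n / (1 - q n)) <= rho n <= 1 /\ `|rho n| <= 1) ->
  bernoulli_strong_detection alpha q rho d ->
  n%:R * (d n)%:R * q n * `|rho n| @[n --> \oo] --> +oo.
Proof.
move=> halpha hq hrho detect; apply/cvgryPge => A.
(* If [n * d * q * `|rho| < A], the overlap [(1 - u) ^+ (d * m)] with
   [u <= 2 * q * `|rho|] is at least [expR (- (2 * u * d * m)) >= expR (- (4 * A))],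
   whereas each error would be below half of that. *)
pose e : R := expR (- (4 * A)) / 2.
have e0 : 0 < e by rewrite divr_gt0 // expR_gt0.
have err := detection_errors detect e0.
apply: filterS err => n [phi [T1 T2]]; rewrite leNgt; apply/negP => lt_A.
have [mn _] := sample_size_le n halpha.
have [hrho1 hrho2] := hrho n.
have := iid_bernoulli_errors_ge phi (hq n) hrho1 mn.
apply/negP; rewrite -ltNge.
apply: lt_le_trans (_ : expR (- (4 * A)) <= _); first by rewrite /e in T1 T2; lra.
set u := 2 * (q n * (1 - q n)) * `|rho n|.
have /andP[q0 q2] := hq n.
have rho0 : 0 <= `|rho n| by [].
have u0 : 0 <= u by rewrite /u !mulr_ge0 //; lra.
have qv : 0 <= q n * (1 - q n) <= 1 / 4 by apply/andP; split; nra.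
have uq : u <= 2 * (q n * `|rho n|) by rewrite /u; nra.
have u2 : u <= 1 / 2 by rewrite /u; nra.
have step : expR (- (2 * u)) <= 1 - u.
  rewrite expRN -[leLHS]mul1r ler_pdivrMr ?expR_gt0 //.
  apply: (@le_trans _ _ ((1 - u) * (1 + 2 * u))); first nra.
  by rewrite ler_wpM2l ?expR_ge1Dx //; lra.
apply: (@le_trans _ _ (expR (- (2 * u)) ^+ (d n * Num.truncn (alpha * n%:R)))); last first.
  by apply: lerXn2r; rewrite ?nnegrE ?expR_ge0 //; lra.
rewrite -expRM_natl ler_expR mulrN lerN2 natrM.
have : (Num.truncn (alpha * n%:R))%:R <= n%:R :> R by rewrite ler_nat.
set M := (Num.truncn (alpha * n%:R))%:R => leM.
have D0 : 0 <= (d n)%:R :> R by [].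
have M0 : 0 <= M by rewrite /M.
have h1 : (d n)%:R * M * (2 * u) <= (d n)%:R * n%:R * (4 * (q n * `|rho n|)).
  by apply: ler_pM; rewrite ?mulr_ge0 ?ler_wpM2l //; lra.
lra.
Qed.

(** * Building tests: moments of centred bits under a planted matching *)

(** The likelihood ratio test minimizes the sum of the errors, so tests that reach
    each fixed precision give one sequence of tests, without a diagonal
    argument. *)
Lemma detection_of_errors (R : realType) (X Y : nat -> finType)
    (P : forall n, X n -> Y n -> R) (m : nat -> nat) :
  (forall n a b, 0 <= P n a b) ->
  (forall eps : R, 0 < eps -> \forall n \near \oo,
     exists phi : {ffun 'I_n -> X n} -> {ffun 'I_(m n) -> Y n} -> bool,
       type1_error (P n) phi + type2_error (P n) phi < eps) ->
  strong_detection P m.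
Proof.
move=> P0 small.
have null0 n x y : 0 <= null_law (P n) (n := n) (m := m n) x y.
  by apply: mulr_ge0; apply: prodr_ge0 => i _; apply: sumr_ge0.
have planted0 n x y : 0 <= planted_law (P n) (n := n) (m := m n) x y.
  apply: sumr_ge0 => s _; rewrite mulr_ge0 ?invr_ge0 ?ler0n //.
  apply: mulr_ge0; apply: prodr_ge0 => // i _; exact: sumr_ge0.
pose lr n (x : {ffun 'I_n -> X n}) (y : {ffun 'I_(m n) -> Y n}) : bool :=
  null_law (P n) x y < planted_law (P n) x y.
have err1 n : 0 <= type1_error (P n) (@lr n).
  by apply: sumr_ge0 => x _; apply: sumr_ge0.
have err2 n : 0 <= type2_error (P n) (@lr n).
  by apply: sumr_ge0 => x _; apply: sumr_ge0.
have best n (phi : {ffun 'I_n -> X n} -> {ffun 'I_(m n) -> Y n} -> bool) :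
    type1_error (P n) (@lr n) + type2_error (P n) (@lr n) <=
    type1_error (P n) phi + type2_error (P n) phi.
  rewrite /type1_error /type2_error /event_prob.
  rewrite -big_split -[leRHS]big_split /=; apply: ler_sum => x _.
  rewrite [\sum_(b | lr n x b) _]big_mkcond [\sum_(b | ~~ lr n x b) _]big_mkcond.
  rewrite [\sum_(b | phi x b) _]big_mkcond [\sum_(b | ~~ phi x b) _]big_mkcond.
  rewrite -big_split -[leRHS]big_split /=; apply: ler_sum => y _.
  by rewrite /lr; case: ltP => [/ltW|] le_xy; case: (phi x y);
    rewrite /= ?addr0 ?add0r.
exists lr; split; apply/cvgr0Pnorm_lt => eps eps0;
  apply: filterS (small eps eps0) => n [phi small_n];
  rewrite ger0_norm //; apply: le_lt_trans small_n;
  apply: le_trans (best n phi).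
  by rewrite lerDl.
by rewrite lerDr.
Qed.

Lemma markov_event (R : realType) (A B : finType) (L F : A -> B -> R)
    (E : A -> B -> bool) (c : R) :
  0 < c -> (forall a b, 0 <= L a b) -> (forall a b, 0 <= F a b) ->
  (forall a b, E a b -> c <= F a b) ->
  event_prob L E <= (\sum_a \sum_b L a b * F a b) / c.
Proof.
move=> c0 L0 F0 EF; rewrite ler_pdivlMr // mulr_suml; apply: ler_sum => a _.
rewrite mulr_suml big_mkcond /=; apply: ler_sum => b _.
by case: ifP => [/EF cF|_]; [apply: ler_wpM2l | apply: mulr_ge0].
Qed.

Definition bernoulli_moment (R : realType) (q rho : R) (i j : nat) : R :=
  \sum_a \sum_b bernoulli_pair q rho a b * ((a%:R - q) ^+ i * (b%:R - q) ^+ j).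

Definition centred (R : realType) (q : R) (n d : nat)
    (x : {ffun 'I_n -> {ffun 'I_d -> bool}}) (t : 'I_n * 'I_d) : R :=
  (x t.1 t.2)%:R - q.

(** Expectation under the alternative given the matching [s]; at [rho = 0] it is
    the expectation under the null hypothesis, for any [s]. *)
Definition planted_mean (R : realType) (q rho : R) (d n m : nat)
    (s : {ffun 'I_m -> 'I_n})
    (F : {ffun 'I_n -> {ffun 'I_d -> bool}} ->
         {ffun 'I_m -> {ffun 'I_d -> bool}} -> R) : R :=
  \sum_x \sum_y planted_law_given (@iid_pair R (bernoulli_pair q rho) d) s x y * F x y.

(** The bit of [x] that is correlated with the bit [u] of [y]. *)
Definition site (m n d : nat) (s : {ffun 'I_m -> 'I_n}) (u : 'I_m * 'I_d) :
  'I_n * 'I_d := (s u.1, u.2).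

Lemma big_pairs (T : Type) (idx : T) (op : Monoid.com_law idx) (I J : finType)
    (F : I * J -> T) :
  \big[op/idx]_t F t = \big[op/idx]_i \big[op/idx]_j F (i, j).
Proof. by rewrite pair_bigA /=; apply: eq_bigr => -[i j]. Qed.

(** Bits at distinct sites are independent, so the expectation of a monomial is
    a product of two-variable moments, one for each site of [x]; the exponents of
    [y] are moved to the partner sites. *)
Lemma planted_mean_monomial (R : realType) (q rho : R) (d n m : nat)
    (s : {ffun 'I_m -> 'I_n}) (a b : 'I_n * 'I_d -> nat) :
  injective s -> (forall j k, j \notin codom s -> b (j, k) = 0%N) ->
  planted_mean q rho s (fun x y =>
    (\prod_t centred q x t ^+ a t) * \prod_u centred q y u ^+ b (site s u)) =
  \prod_t bernoulli_moment q rho (a t) (b t).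
Proof.
move=> s_inj b0; rewrite /planted_mean.
pose Q i (u v : {ffun 'I_d -> bool}) : R := \prod_k
  (bernoulli_pair q rho (u k) (v k) *
   (((u k)%:R - q) ^+ a (s i, k) * ((v k)%:R - q) ^+ b (s i, k))).
pose r j (u : {ffun 'I_d -> bool}) : R := \prod_k
  (bernoulli q (u k) * ((u k)%:R - q) ^+ a (j, k)).
transitivity (\sum_(x : {ffun 'I_n -> {ffun 'I_d -> bool}})
  \sum_(y : {ffun 'I_m -> {ffun 'I_d -> bool}})
  (\prod_i Q i (x (s i)) (y i)) * \prod_(j | j \notin codom s) r j (x j)).
  apply: eq_bigr => x _; apply: eq_bigr => y _.
  have -> : \prod_t centred q x t ^+ a t =
      (\prod_i \prod_k ((x (s i) k)%:R - q) ^+ a (s i, k)) *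
      \prod_(j | j \notin codom s) \prod_k ((x j k)%:R - q) ^+ a (j, k).
    by rewrite big_pairs (bigID (mem (codom s))) /= big_codom.
  have -> : \prod_u centred q y u ^+ b (site s u) =
      \prod_i \prod_k ((y i k)%:R - q) ^+ b (s i, k).
    exact: big_pairs.
  rewrite /planted_law_given /iid_pair /Q /r.
  under [X in (_ * X) * _ = _]eq_bigr do rewrite iid_pair_marginalX.
  under [X in (_ * X) * _ = _]eq_bigr do under eq_bigr do
    rewrite bernoulli_pair_marginalX.
  under [X in _ = X * _]eq_bigr do rewrite 2!big_split /=.
  under [X in _ = _ * X]eq_bigr do rewrite big_split /=.
  rewrite !big_split /=; ring.
rewrite (sum_coupled Q r s_inj).
rewrite [RHS]big_pairs [RHS](bigID (mem (codom s))) /= big_codom //; congr (_ * _).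
  apply: eq_bigr => i _.
  by rewrite (sum_iid_pair (fun k u v => bernoulli_pair q rho u v *
   ((u%:R - q) ^+ a (s i, k) * (v%:R - q) ^+ b (s i, k)))).
apply: eq_bigr => j jNs.
rewrite -(bigA_distr_bigA (fun k u => bernoulli q u * (u%:R - q) ^+ a (j, k))) /=.
apply: eq_bigr => k _; rewrite /bernoulli_moment b0 //.
by rewrite !big_bool /=; ring.
Qed.

Lemma bernoulli_moment_small (R : realType) (q rho : R) :
  [/\ bernoulli_moment q rho 0 0 = 1, bernoulli_moment q rho 1 0 = 0,
      bernoulli_moment q rho 0 1 = 0,
      bernoulli_moment q rho 2 0 = q * (1 - q) &
      bernoulli_moment q rho 0 2 = q * (1 - q)].
Proof. by split; rewrite /bernoulli_moment !big_bool /=; ring. Qed.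

Lemma bernoulli_moment11 (R : realType) (q rho : R) :
  bernoulli_moment q rho 1 1 = rho * (q * (1 - q)).
Proof. by rewrite /bernoulli_moment !big_bool /=; ring. Qed.

Lemma bernoulli_moment22 (R : realType) (q rho : R) :
  bernoulli_moment q rho 2 2 =
  (q * (1 - q)) ^+ 2 + (1 - 2 * q) ^+ 2 * rho * (q * (1 - q)).
Proof. by rewrite /bernoulli_moment !big_bool /=; ring. Qed.

Lemma prod_count_mem (R : realType) (T : finType) (F : T -> R) (A : seq T) :
  \prod_(t <- A) F t = \prod_t F t ^+ count_mem t A.
Proof.
elim: A => [|a A IH]; first by rewrite big_nil big1.
rewrite big_cons IH /=; under [RHS]eq_bigr do rewrite exprD.
rewrite big_split /=; congr (_ * _).
rewrite (bigD1 a) //= eqxx expr1 big1 ?mulr1 // => t /negPf.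
by rewrite eq_sym => ->.
Qed.

Lemma site_inj (m n d : nat) (s : {ffun 'I_m -> 'I_n}) :
  injective s -> injective (@site m n d s).
Proof. by move=> s_inj [i k] [j l] [/s_inj -> ->]. Qed.

Lemma planted_mean_seq (R : realType) (q rho : R) (d n m : nat)
    (s : {ffun 'I_m -> 'I_n}) (A : seq ('I_n * 'I_d)) (B : seq ('I_m * 'I_d)) :
  injective s ->
  planted_mean q rho s (fun x y =>
    (\prod_(t <- A) centred q x t) * \prod_(u <- B) centred q y u) =
  \prod_t bernoulli_moment q rho (count_mem t A) (count_mem t (map (site s) B)).
Proof.
move=> s_inj; rewrite -(planted_mean_monomial q rho (fun t => count_mem t A)
  (b := fun t => count_mem t (map (site s) B)) s_inj); last first.
  move=> j k jNs; apply/count_memPn; apply: contra jNs => /mapP[[i l] _ [-> _]].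
  exact: codom_f.
apply: eq_bigr => x _; apply: eq_bigr => y _; rewrite (prod_count_mem _ A) (prod_count_mem _ B).
congr (_ * (_ * _)); apply: eq_bigr => u _; congr (_ ^+ _).
by rewrite count_map; apply: eq_count => v /=; rewrite (inj_eq (site_inj s_inj)).
Qed.

Lemma prod_moments_xy (R : realType) (q rho : R) (T : finType) (t w : T) :
  \prod_z bernoulli_moment q rho (count_mem z [:: t]) (count_mem z [:: w]) =
  (t == w)%:R * (rho * (q * (1 - q))).
Proof.
have [m00 m10 m01 _ _] := bernoulli_moment_small q rho.
rewrite (bigD1 t) //= eqxx !addn0; have [->|tw] := eqVneq t w; last first.
  by rewrite m10 !mul0r.
rewrite bernoulli_moment11 big1 ?mulr1 ?mul1r // => z.
by rewrite eq_sym => /negPf ->; rewrite m00.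
Qed.

Lemma prod_moments_xx (R : realType) (q rho : R) (T : finType) (t1 t2 : T) :
  \prod_z bernoulli_moment q rho (count_mem z [:: t1; t2]) 0 =
  (t1 == t2)%:R * (q * (1 - q)).
Proof.
have [m00 m10 _ m20 _] := bernoulli_moment_small q rho.
rewrite (bigD1 t1) //= eqxx !addn0; have [<-|tw] := eqVneq t1 t2; last first.
  by rewrite m10 !mul0r.
rewrite m20 big1 ?mulr1 ?mul1r // => z.
by rewrite eq_sym => /negPf ->; rewrite m00.
Qed.

Lemma prod_moments_yy (R : realType) (q rho : R) (T : finType) (w1 w2 : T) :
  \prod_z bernoulli_moment q rho 0 (count_mem z [:: w1; w2]) =
  (w1 == w2)%:R * (q * (1 - q)).
Proof.
have [m00 _ m01 _ m02] := bernoulli_moment_small q rho.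
rewrite (bigD1 w1) //= eqxx !addn0; have [<-|tw] := eqVneq w1 w2; last first.
  by rewrite m01 !mul0r.
rewrite m02 big1 ?mulr1 ?mul1r // => z.
by rewrite eq_sym => /negPf ->; rewrite m00.
Qed.

(** A moment of four centred bits vanishes unless they can be grouped in pairs of
    correlated or equal bits.  When all four sit at the same site the moment has
    a further term [(1 - 2 * q) ^+ 2 * rho * (q * (1 - q))], which is not small
    compared with the square of the variance when [q] is small; it is the origin
    of the condition on [n d q |rho|]. *)
Lemma prod_moments_xyxy_le (R : realType) (q rho : R) (T : finType)
    (t1 t2 w1 w2 : T) :
  0 < q <= 1 / 2 ->
  \prod_z bernoulli_moment q rho (count_mem z [:: t1; t2])
                                 (count_mem z [:: w1; w2]) <=
  ((t1 == w1)%:R * (rho * (q * (1 - q)))) * ((t2 == w2)%:R * (rho * (q * (1 - q)))) +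
  ((t1 == t2) && (w1 == w2))%:R *
    ((q * (1 - q)) ^+ 2 + (t1 == w1)%:R * (`|rho| * (q * (1 - q)))) +
  ((t1 == w2) && (t2 == w1))%:R * (rho * (q * (1 - q))) ^+ 2.
Proof.
move=> /andP[q0 q2].
have [m00 m10 m01 m20 m02] := bernoulli_moment_small q rho.
set v := q * (1 - q) in m20 m02 *; set c := rho * v.
have v0 : 0 <= v by rewrite /v; nra.
have c2 : 0 <= c ^+ 2 by exact: sqr_ge0.
have zero z : bernoulli_moment q rho (count_mem z [:: t1; t2])
      (count_mem z [:: w1; w2]) = 0 ->
    \prod_z bernoulli_moment q rho (count_mem z [:: t1; t2])
      (count_mem z [:: w1; w2]) = 0.
  by move=> z0; rewrite (bigD1 z) //= [X in X * _]z0 mul0r.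
have rhs0 : 0 <= (t1 == w1)%:R * c * ((t2 == w2)%:R * c) +
    ((t1 == t2) && (w1 == w2))%:R * (v ^+ 2 + (t1 == w1)%:R * (`|rho| * v)) +
    ((t1 == w2) && (t2 == w1))%:R * c ^+ 2.
  rewrite mulrACA -expr2; apply: addr_ge0; first apply: addr_ge0.
  - by apply: mulr_ge0 c2; apply: mulr_ge0; exact: ler0n.
  - apply: mulr_ge0; first exact: ler0n.
    apply: addr_ge0; first exact: sqr_ge0.
    by apply: mulr_ge0; [exact: ler0n | exact: mulr_ge0].
  - by apply: mulr_ge0 c2; exact: ler0n.
move: zero rhs0; have [<-|t12] := eqVneq t1 t2;
  have [<-|w12] := eqVneq w1 w2 => zero rhs0.
- have [tw|tw] := eqVneq t1 w1.
    rewrite -tw (bigD1 t1) //= eqxx bernoulli_moment22 big1; last first.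
      by move=> z; rewrite eq_sym => /negPf ->; rewrite m00.
    rewrite mulr1 !mul1r -/v.
    have : (1 - 2 * q) ^+ 2 * rho * v <= `|rho| * v.
      apply: ler_wpM2r => //; apply: le_trans (ler_norm _) _.
      rewrite normrM ler_piMl // ger0_norm ?sqr_ge0 //; nra.
    have : 0 <= c * c by rewrite -expr2.
    lra.
  rewrite (bigD1 t1) //= (bigD1 w1) /=; last by rewrite eq_sym.
  rewrite !eqxx (negPf tw) [w1 == t1]eq_sym (negPf tw) /= m20 m02 big1; last first.
    by move=> z /andP[]; rewrite eq_sym => /negPf ->; rewrite eq_sym => /negPf ->.
  by rewrite !mul0r !mulr1 mul1r -expr2; lra.
- move: rhs0; have [tw|tw] := eqVneq t1 w1 => rhs0.
    by rewrite (zero w2) //= tw eqxx (negPf w12).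
  by rewrite (zero w1) //= (negPf tw) eqxx [w2 == w1]eq_sym (negPf w12).
- move: rhs0; have [tw|tw] := eqVneq t1 w1 => rhs0.
    by rewrite (zero t2) //= -tw eqxx (negPf t12).
  by rewrite (zero t1) //= eqxx [t2 == t1]eq_sym (negPf t12) [w1 == t1]eq_sym (negPf tw).
have zt1 : t1 != w1 -> t1 != w2 ->
    \prod_z bernoulli_moment q rho (count_mem z [:: t1; t2])
      (count_mem z [:: w1; w2]) = 0.
  move=> /negPf n1 /negPf n2; apply: (zero t1) => /=.
  by rewrite eqxx ![_ == t1]eq_sym (negPf t12) n1 n2.
have zt2 : t2 != w1 -> t2 != w2 ->
    \prod_z bernoulli_moment q rho (count_mem z [:: t1; t2])
      (count_mem z [:: w1; w2]) = 0.
  move=> /negPf n1 /negPf n2; apply: (zero t2) => /=.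
  by rewrite eqxx ![_ == t2]eq_sym [t2 == t1]eq_sym (negPf t12) n1 n2.
have full : (t1 == w1) && (t2 == w2) || (t1 == w2) && (t2 == w1) ->
    \prod_z bernoulli_moment q rho (count_mem z [:: t1; t2])
      (count_mem z [:: w1; w2]) = c ^+ 2.
  move=> tws; rewrite (bigD1 t1) //= (bigD1 t2) /=; last by rewrite eq_sym.
  rewrite !eqxx (negPf t12) [t2 == t1]eq_sym (negPf t12) big1; last first.
    move=> z /andP[]; rewrite ![z == _]eq_sym => /negPf n1 /negPf n2.
    by case/orP: tws => /andP[/eqP <- /eqP <-]; rewrite n1 n2.
  rewrite mulr1; case/orP: tws => /andP[/eqP <- /eqP <-];
    by rewrite !eqxx (negPf t12) [t2 == t1]eq_sym (negPf t12) /= bernoulli_moment11.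
have [P1|[P2|-> //]] : (t1 == w1) && (t2 == w2) \/ (t1 == w2) && (t2 == w1) \/
    \prod_z bernoulli_moment q rho (count_mem z [:: t1; t2])
      (count_mem z [:: w1; w2]) = 0.
- have [_|nP1] := boolP ((t1 == w1) && (t2 == w2)); first by left.
  have [_|nP2] := boolP ((t1 == w2) && (t2 == w1)); first by right; left.
  right; right; have [tw12|tw12] := eqVneq t1 w2.
    by apply: zt2; [rewrite tw12 eqxx /= in nP2 | rewrite -tw12 eq_sym].
  have [tw11|tw11] := eqVneq t1 w1; last exact: zt1.
  by apply: zt2; [rewrite -tw11 eq_sym | rewrite tw11 eqxx /= in nP1].
- rewrite full ?P1 //; case/andP: P1 => -> ->.
  by rewrite /= !mul1r mul0r addr0 -expr2 lerDl mulr_ge0 ?ler0n.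
rewrite full ?P2 ?orbT // /= mul0r addr0 mul1r lerDr mulrACA -expr2.
by apply: mulr_ge0 c2; rewrite mulr_ge0 ?ler0n.
Qed.

(** * The cross statistic and detection in growing dimension *)

Lemma planted_mean_sum (R : realType) (q rho : R) (d n m : nat)
    (s : {ffun 'I_m -> 'I_n}) (I : finType)
    (F : I -> {ffun 'I_n -> {ffun 'I_d -> bool}} ->
         {ffun 'I_m -> {ffun 'I_d -> bool}} -> R) :
  planted_mean q rho s (fun x y => \sum_i F i x y) =
  \sum_i planted_mean q rho s (F i).
Proof.
rewrite /planted_mean; under eq_bigr do under eq_bigr do rewrite mulr_sumr.
under eq_bigr do rewrite exchange_big /=.
by rewrite exchange_big.
Qed.

Lemma planted_meanD (R : realType) (q rho : R) (d n m : nat)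
    (s : {ffun 'I_m -> 'I_n})
    (F G : {ffun 'I_n -> {ffun 'I_d -> bool}} ->
           {ffun 'I_m -> {ffun 'I_d -> bool}} -> R) :
  planted_mean q rho s (fun x y => F x y + G x y) =
  planted_mean q rho s F + planted_mean q rho s G.
Proof.
rewrite /planted_mean -big_split; apply: eq_bigr => x _ /=.
by rewrite -big_split; apply: eq_bigr => y _ /=; rewrite mulrDr.
Qed.

Lemma planted_meanZ (R : realType) (q rho : R) (d n m : nat)
    (s : {ffun 'I_m -> 'I_n}) (c : R)
    (F : {ffun 'I_n -> {ffun 'I_d -> bool}} ->
         {ffun 'I_m -> {ffun 'I_d -> bool}} -> R) :
  planted_mean q rho s (fun x y => c * F x y) = c * planted_mean q rho s F.
Proof.
rewrite /planted_mean mulr_sumr; apply: eq_bigr => x _.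
by rewrite mulr_sumr; apply: eq_bigr => y _; rewrite mulrCA.
Qed.

Lemma planted_mean_cst (R : realType) (q rho : R) (d n m : nat)
    (s : {ffun 'I_m -> 'I_n}) (c : R) :
  injective s -> planted_mean (d := d) q rho s (fun _ _ => c) = c.
Proof.
move=> s_inj; rewrite /planted_mean.
under eq_bigr do rewrite -mulr_suml.
rewrite -mulr_suml planted_law_given_mass ?mul1r //.
exact/iid_pair_mass/bernoulli_pair_mass.
Qed.

Lemma planted_mean_ext (R : realType) (q rho : R) (d n m : nat)
    (s : {ffun 'I_m -> 'I_n})
    (F G : {ffun 'I_n -> {ffun 'I_d -> bool}} ->
           {ffun 'I_m -> {ffun 'I_d -> bool}} -> R) :
  (forall x y, F x y = G x y) ->
  planted_mean q rho s F = planted_mean q rho s G.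
Proof.
by move=> FG; apply: eq_bigr => x _; apply: eq_bigr => y _; rewrite FG.
Qed.

Definition siteX (n m d : nat) (r : 'I_d * ('I_n * 'I_m)) : 'I_n * 'I_d :=
  (r.2.1, r.1).

Definition siteY (n m d : nat) (r : 'I_d * ('I_n * 'I_m)) : 'I_m * 'I_d :=
  (r.2.2, r.1).

(** The sum over the coordinates of the product of the column sums of [x] and of
    [y]: it does not depend on the matching, while the planted correlation gives
    it the mean [d * m * (rho * (q * (1 - q)))].  The index is a coordinate and two
    samples. *)
Definition cross_statistic (R : realType) (q : R) (n m d : nat)
    (x : {ffun 'I_n -> {ffun 'I_d -> bool}})
    (y : {ffun 'I_m -> {ffun 'I_d -> bool}}) : R :=
  \sum_(r : 'I_d * ('I_n * 'I_m)) centred q x (siteX r) * centred q y (siteY r).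

Lemma sum_indicator (R : realType) (I : finType) (i : I) (F : I -> R) :
  \sum_j (j == i)%:R * F j = F i.
Proof.
rewrite (bigD1 i) //= eqxx mul1r big1 ?addr0 // => j /negPf ->.
by rewrite mul0r.
Qed.

Lemma count_matched (R : realType) (n m d : nat) (s : {ffun 'I_m -> 'I_n}) :
  \sum_(r : 'I_d * ('I_n * 'I_m)) (siteX r == site s (siteY r))%:R =
  d%:R * m%:R :> R.
Proof.
rewrite big_pairs; under eq_bigr do rewrite big_pairs exchange_big /=.
transitivity (\sum_(k < d) \sum_(i < m) (1 : R)).
  apply: eq_bigr => k _; apply: eq_bigr => i _.
  rewrite -[RHS](sum_indicator (s i) (fun=> 1)); apply: eq_bigr => j _.
  by rewrite mulr1 /siteX /site /= xpair_eqE eqxx andbT.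
by rewrite !sumr_const !card_ord -[LHS]mulr_natr mulrC.
Qed.

(** The pairs of terms of the cross statistic whose four bits are correlated
    crosswise. *)
Lemma count_swapped (R : realType) (n m d : nat) (s : {ffun 'I_m -> 'I_n}) :
  \sum_(r : 'I_d * ('I_n * 'I_m)) \sum_(r' : 'I_d * ('I_n * 'I_m))
    ((siteX r == site s (siteY r')) && (siteX r' == site s (siteY r)))%:R =
  d%:R * m%:R ^+ 2 :> R.
Proof.
transitivity (\sum_(k < d) \sum_(i < m) \sum_(i' < m) (1 : R)); last first.
  by rewrite !sumr_const !card_ord -[LHS]mulr_natr -[_ *+ m *+ m]mulr_natr; ring.
rewrite big_pairs; apply: eq_bigr => k _.
rewrite big_pairs exchange_big /=; apply: eq_bigr => i _.
transitivity (\sum_(j < n) \sum_(i' < m) ((j == s i')%:R : R)).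
  apply: eq_bigr => j _.
  rewrite big_pairs -[RHS](sum_indicator k (fun k' => \sum_(i' < m) (j == s i')%:R)).
  apply: eq_bigr => k' _.
  rewrite big_pairs mulr_sumr exchange_big /=; apply: eq_bigr => i' _.
  rewrite -[RHS](sum_indicator (s i) (fun=> (k' == k)%:R * (j == s i')%:R)).
  apply: eq_bigr => j' _; rewrite /siteX /site /= !xpair_eqE [k == k']eq_sym.
  by case: (j == s i'); case: (k' == k); case: (j' == s i) => /=; ring.
rewrite exchange_big /=; apply: eq_bigr => i' _.
by rewrite -[RHS](sum_indicator (s i') (fun=> 1)); apply: eq_bigr => j _; rewrite mulr1.
Qed.

Lemma cross_statistic_mean (R : realType) (q rho : R) (d n m : nat)
    (s : {ffun 'I_m -> 'I_n}) :
  injective s ->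
  planted_mean (d := d) q rho s (@cross_statistic R q n m d) =
  d%:R * m%:R * (rho * (q * (1 - q))).
Proof.
move=> s_inj; rewrite planted_mean_sum -(count_matched R _ s) mulr_suml.
apply: eq_bigr => r _; rewrite -prod_moments_xy.
rewrite -[in RHS](map_cons (site s) (siteY r) [::]).
rewrite -(planted_mean_seq q rho [:: siteX r] [:: siteY r] s_inj).
by apply: planted_mean_ext => x y; rewrite !big_seq1.
Qed.

Lemma cross_statistic_second_moment (R : realType) (q rho : R) (d n m : nat)
    (s : {ffun 'I_m -> 'I_n}) :
  injective s -> 0 < q <= 1 / 2 ->
  planted_mean (d := d) q rho s (fun x y => cross_statistic q x y ^+ 2) <=
  (d%:R * m%:R * (rho * (q * (1 - q)))) ^+ 2 +
  d%:R * (n%:R * m%:R * (q * (1 - q)) ^+ 2 + m%:R * (`|rho| * (q * (1 - q))) +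
          m%:R ^+ 2 * (rho * (q * (1 - q))) ^+ 2).
Proof.
move=> s_inj hq.
set v := q * (1 - q); set c := rho * v.
pose M (r r' : 'I_d * ('I_n * 'I_m)) : R :=
  \prod_z bernoulli_moment q rho (count_mem z [:: siteX r; siteX r'])
    (count_mem z [:: site s (siteY r); site s (siteY r')]).
have -> : planted_mean (d := d) q rho s (fun x y => cross_statistic q x y ^+ 2) =
    \sum_r \sum_r' M r r'.
  rewrite (@planted_mean_ext _ _ _ _ _ _ _ _ (fun x y => \sum_r \sum_r'
    (\prod_(t <- [:: siteX r; siteX r']) centred q x t) *
    \prod_(u <- [:: siteY r; siteY r']) centred q y u)); last first.
    move=> x y; rewrite expr2 mulr_suml; apply: eq_bigr => r _.
    rewrite mulr_sumr; apply: eq_bigr => r' _.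
    by rewrite !big_cons !big_nil; ring.
  rewrite planted_mean_sum; apply: eq_bigr => r _.
  rewrite planted_mean_sum; apply: eq_bigr => r' _.
  exact: planted_mean_seq.
pose matched (r : 'I_d * ('I_n * 'I_m)) : R := (siteX r == site s (siteY r))%:R.
apply: (@le_trans _ _ (\sum_r \sum_r'
  ((matched r * c) * (matched r' * c) +
   (r' == r)%:R * (v ^+ 2 + matched r * (`|rho| * v)) +
   ((siteX r == site s (siteY r')) && (siteX r' == site s (siteY r)))%:R * c ^+ 2))).
  apply: ler_sum => r _; apply: ler_sum => r' _.
  have -> : (r' == r) = (siteX r == siteX r') && (site s (siteY r) == site s (siteY r')).
    case: r r' => [k [j i]] [k' [j' i']].
    rewrite /siteX /site /= !xpair_eqE (inj_eq s_inj) [i' == i]eq_sym.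
    rewrite [j' == j]eq_sym [k' == k]eq_sym.
    by case: (k == k'); case: (j == j'); case: (i == i').
  exact: prod_moments_xyxy_le.
under eq_bigr do rewrite !big_split /= -mulr_sumr -mulr_suml sum_indicator -mulr_suml.
rewrite !big_split /= -!mulr_suml count_matched count_swapped sumr_const.
rewrite card_prod card_prod !card_ord -[q *+ _]mulr_natr !natrM.
by rewrite le_eqVlt; apply/orP; left; apply/eqP; rewrite /c /v; ring.
Qed.

Lemma cross_statistic_variance (R : realType) (q rho : R) (d n m : nat)
    (s : {ffun 'I_m -> 'I_n}) :
  injective s -> 0 < q <= 1 / 2 ->
  planted_mean (d := d) q rho s
    (fun x y => (cross_statistic q x y - d%:R * m%:R * (rho * (q * (1 - q)))) ^+ 2) <=
  d%:R * (n%:R * m%:R * (q * (1 - q)) ^+ 2 + m%:R * (`|rho| * (q * (1 - q))) +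
          m%:R ^+ 2 * (rho * (q * (1 - q))) ^+ 2).
Proof.
move=> s_inj hq; set mu := d%:R * m%:R * (rho * (q * (1 - q))).
rewrite (@planted_mean_ext _ _ _ _ _ _ _ _ (fun x y =>
  cross_statistic q x y ^+ 2 + (- (2 * mu)) * cross_statistic q x y + mu ^+ 2)); last first.
  by move=> x y; ring.
rewrite 2!planted_meanD planted_meanZ planted_mean_cst // cross_statistic_mean // -/mu.
have := cross_statistic_second_moment rho d s_inj hq; rewrite -/mu; lra.
Qed.

Lemma null_law_planted (R : realType) (q rho : R) (d n m : nat)
    (s : {ffun 'I_m -> 'I_n}) (x : {ffun 'I_n -> {ffun 'I_d -> bool}})
    (y : {ffun 'I_m -> {ffun 'I_d -> bool}}) :
  injective s ->
  null_law (@iid_pair R (bernoulli_pair q rho) d) x y =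
  planted_law_given (@iid_pair R (bernoulli_pair q 0) d) s x y.
Proof.
move=> s_inj; rewrite (null_law_coupled _ _ _ s_inj) /planted_law_given.
have marg r u : marginalX (@iid_pair R (bernoulli_pair q r) d) u =
    \prod_k bernoulli q (u k).
  by rewrite iid_pair_marginalX; apply: eq_bigr => k _; rewrite bernoulli_pair_marginalX.
congr (_ * _); last by apply: eq_bigr => j _; rewrite !marg.
apply: eq_bigr => i _; rewrite marg iid_pair_marginalY -big_split /=.
apply: eq_bigr => k _; rewrite bernoulli_pair_marginalY /bernoulli.
by case: (x (s i) k); case: (y i k) => /=; ring.
Qed.

Lemma planted_law_given_ge0 (R : realType) (q rho : R) (d n m : nat)
    (s : {ffun 'I_m -> 'I_n}) (x : {ffun 'I_n -> {ffun 'I_d -> bool}})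
    (y : {ffun 'I_m -> {ffun 'I_d -> bool}}) :
  0 < q <= 1 / 2 -> - (q / (1 - q)) <= rho <= 1 ->
  0 <= planted_law_given (@iid_pair R (bernoulli_pair q rho) d) s x y.
Proof.
move=> hq hrho.
have P0 u v : 0 <= @iid_pair R (bernoulli_pair q rho) d u v.
  by apply: iid_pair_ge0 => a b; exact: bernoulli_pair_ge0.
by apply: mulr_ge0; apply: prodr_ge0 => // j _; apply: sumr_ge0.
Qed.

Lemma type1_error_le (R : realType) (q rho : R) (d n m : nat)
    (s : {ffun 'I_m -> 'I_n})
    (F : {ffun 'I_n -> {ffun 'I_d -> bool}} ->
         {ffun 'I_m -> {ffun 'I_d -> bool}} -> R)
    (phi : {ffun 'I_n -> {ffun 'I_d -> bool}} ->
           {ffun 'I_m -> {ffun 'I_d -> bool}} -> bool) (c : R) :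
  0 < q <= 1 / 2 -> injective s -> 0 < c ->
  (forall x y, 0 <= F x y) -> (forall x y, phi x y -> c <= F x y) ->
  type1_error (@iid_pair R (bernoulli_pair q rho) d) phi <=
  planted_mean q 0 s F / c.
Proof.
move=> hq s_inj c0 F0 cF; rewrite /type1_error /event_prob.
under eq_bigr do under eq_bigr do rewrite (null_law_planted _ _ _ _ s_inj).
apply: (markov_event c0) => // x y; apply: planted_law_given_ge0 => //.
move: hq => /andP[q0 q2]; rewrite ler01 andbT oppr_le0 divr_ge0 //; lra.
Qed.

Lemma type2_error_le (R : realType) (q rho : R) (d n m : nat)
    (F : {ffun 'I_n -> {ffun 'I_d -> bool}} ->
         {ffun 'I_m -> {ffun 'I_d -> bool}} -> R)
    (phi : {ffun 'I_n -> {ffun 'I_d -> bool}} ->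
           {ffun 'I_m -> {ffun 'I_d -> bool}} -> bool) (c B : R) :
  0 < q <= 1 / 2 -> - (q / (1 - q)) <= rho <= 1 -> (m <= n)%N -> 0 < c ->
  (forall x y, 0 <= F x y) -> (forall x y, ~~ phi x y -> c <= F x y) ->
  (forall s : {ffun 'I_m -> 'I_n}, injective s -> planted_mean q rho s F <= B) ->
  type2_error (@iid_pair R (bernoulli_pair q rho) d) phi <= B / c.
Proof.
move=> hq hrho mn c0 F0 cF FB; rewrite type2_errorE.
apply: mean_injections_le => // s s_inj.
apply: (@le_trans _ _ (planted_mean q rho s F / c)).
  by apply: (markov_event c0) => // x y; exact: planted_law_given_ge0.
by rewrite ler_pM2r ?invr_gt0 // FB.
Qed.

(** Chebyshev's inequality with the threshold halfway to the planted mean [mu].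
    Under both hypotheses the variance divided by [mu ^+ 2] is at most of order
    [n / (m d rho ^+ 2) + 1 / (d m |rho| q (1 - q))]. *)
Lemma cross_test_errors (R : realType) (q rho : R) (d n m : nat) :
  0 < q <= 1 / 2 -> - (q / (1 - q)) <= rho <= 1 -> `|rho| <= 1 -> rho != 0 ->
  (0 < m <= n)%N -> (0 < d)%N ->
  exists phi : {ffun 'I_n -> {ffun 'I_d -> bool}} ->
               {ffun 'I_m -> {ffun 'I_d -> bool}} -> bool,
    type1_error (@iid_pair R (bernoulli_pair q rho) d) phi +
    type2_error (@iid_pair R (bernoulli_pair q rho) d) phi <=
    12 * (n%:R / (m%:R * d%:R * rho ^+ 2)) +
    4 / (d%:R * m%:R * (`|rho| * (q * (1 - q)))).
Proof.
move=> hq hrho rho1 rho_neq0 /andP[m0 mn] d0.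
set v := q * (1 - q); set mu := d%:R * m%:R * (rho * v).
have v0 : 0 < v by rewrite /v; move: hq => /andP[]; nra.
have mR : 0 < m%:R :> R by rewrite ltr0n.
have dR : 0 < d%:R :> R by rewrite ltr0n.
have mnR : m%:R <= n%:R :> R by rewrite ler_nat.
have r0 : 0 < `|rho| by rewrite normr_gt0.
have mu_neq0 : mu != 0.
  by apply: mulf_neq0; apply: mulf_neq0 => //; rewrite gt_eqF.
have c0 : 0 < (mu / 2) ^+ 2 by rewrite exprn_even_gt0 //= mulf_neq0 // invr_neq0.
have mu_half : `|mu| = `|mu / 2| + `|mu / 2|.
  by rewrite -mulr2n -normrMn -[_ *+ 2]mulr_natr divfK.
have sq2 (a b : R) : `|b| <= `|a| -> b ^+ 2 <= a ^+ 2.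
  move=> ab; rewrite -(real_normK (num_real a)) -(real_normK (num_real b)).
  by apply: lerXn2r => //; rewrite nnegrE.
pose W := @cross_statistic R q n m d.
exists (fun x y => `|mu / 2| <= `|W x y|).
have [s0 /inj_injections s0_inj] := injections_exists mn.
apply: (@le_trans _ _ (d%:R * (n%:R * m%:R * v ^+ 2) / (mu / 2) ^+ 2 +
  d%:R * (n%:R * m%:R * v ^+ 2 + m%:R * (`|rho| * v) + m%:R ^+ 2 * (rho * v) ^+ 2)
    / (mu / 2) ^+ 2)).
  apply: lerD.
    apply: le_trans (type1_error_le rho hq s0_inj c0
      (F := fun x y => (W x y - d%:R * m%:R * (0 * v)) ^+ 2) _ _) _.
    - by move=> x y; exact: sqr_ge0.
    - by move=> x y; rewrite mul0r mulr0 subr0; exact: sq2.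
    rewrite ler_pM2r ?invr_gt0 //; apply: le_trans (cross_statistic_variance _ _ s0_inj hq) _.
    by rewrite normr0 !mul0r expr0n /= !mulr0 !addr0.
  apply: (type2_error_le hq hrho mn c0 (F := fun x y => (W x y - mu) ^+ 2)).
  - by move=> x y; exact: sqr_ge0.
  - move=> x y; rewrite -ltNge => ltW; apply: sq2.
    have := lerB_dist mu (W x y); rewrite distrC mu_half; lra.
  by move=> s s_inj; exact: cross_statistic_variance.
have rho2 : rho ^+ 2 = `|rho| ^+ 2 by rewrite real_normK ?num_real.
have mu2 : mu ^+ 2 = (d%:R * m%:R * (`|rho| * v)) ^+ 2.
  by rewrite /mu !exprMn rho2.
rewrite ![(mu / 2) ^+ 2]exprMn mu2 [(rho * v) ^+ 2]exprMn rho2.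
move: r0 rho1; set r := `|rho| => r0 r1.
have bound : 1 / d%:R <= n%:R / (m%:R * d%:R * r ^+ 2).
  rewrite ler_pdivlMr ?mulr_gt0 ?exprn_gt0 //.
  rewrite (_ : 1 / d%:R * _ = m%:R * r ^+ 2); last by field; rewrite gt_eqF.
  have rr : r ^+ 2 <= 1 by rewrite expr_le1 // ltW.
  by apply: le_trans mnR; rewrite ler_piMr // ltW.
set a := n%:R / (m%:R * d%:R * r ^+ 2) in bound *.
set b := 4 / (d%:R * m%:R * (r * v)).
rewrite (_ : _ + _ = 8 * a + b + 4 * (1 / d%:R)); first lra.
rewrite /a /b; field; rewrite !gt_eqF //.
Qed.

Lemma sample_size_ge (R : realType) (alpha : R) (n : nat) :
  0 < alpha -> 2 <= alpha * n%:R ->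
  alpha * n%:R / 2 <= (Num.truncn (alpha * n%:R))%:R.
Proof.
move=> a0 an; have /andP[_] := truncn_itv (le_trans (ler0n _ 2) an).
by rewrite -natr1; lra.
Qed.

Lemma detection_large (R : realType) (alpha : R) (q rho : nat -> R)
    (d : nat -> nat) :
  0 < alpha <= 1 -> (forall n, 0 < q n <= 1 / 2) ->
  (forall n, - (q n / (1 - q n)) <= rho n <= 1 /\ `|rho n| <= 1) ->
  rho n ^+ 2 * (d n)%:R @[n --> \oo] --> +oo ->
  n%:R * (d n)%:R * q n * `|rho n| @[n --> \oo] --> +oo ->
  bernoulli_strong_detection alpha q rho d.
Proof.
move=> halpha hq hrho corr signal; have /andP[a0 a1] := halpha.
apply: detection_of_errors.
  move=> n u v; apply: iid_pair_ge0 => a b.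
  by apply: bernoulli_pair_ge0 => //; case: (hrho n).
move=> eps eps0.
(* With [m >= alpha * n / 2] and [q * (1 - q) >= q / 2] the errors are at most
   [24 / (alpha * (rho ^+ 2 * d)) + 16 / (alpha * (n * d * q * `|rho|))]. *)
pose A := 48 / (alpha * eps).
have A0 : 0 < A by rewrite divr_gt0 // mulr_gt0.
have {}corr := (@cvgryPgt _ _ _ eventually_filter _).1 corr A.
have {}signal := (@cvgryPgt _ _ _ eventually_filter _).1 signal A.
have large : \forall n \near \oo, 2 / alpha <= n%:R :> R by exact: nbhs_infty_ger.
apply: filterS3 corr signal large => n corr signal large.
have an : 2 <= alpha * n%:R by rewrite mulrC -ler_pdivrMr.
have mge := sample_size_ge a0 an.
have [mn _] := sample_size_le n halpha.
set m := Num.truncn (alpha * n%:R) in mge mn *.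
have rho_neq0 : rho n != 0.
  by apply: contraTneq corr => ->; rewrite expr0n mul0r ltNge negbK ltW.
have d0 : (0 < d n)%N.
  by rewrite lt0n; apply: contraTneq corr => ->; rewrite mulr0 ltNge negbK ltW.
have m0 : (0 < m)%N by rewrite -(ltr_nat R); apply: lt_le_trans mge; lra.
have [hrho1 hrho2] := hrho n.
have mmn : (0 < m <= n)%N by rewrite m0 mn.
have [phi err] := cross_test_errors (hq n) hrho1 hrho2 rho_neq0 mmn d0.
exists phi; apply: le_lt_trans err _.
have nR : 0 < n%:R :> R by apply: lt_le_trans large; rewrite divr_gt0.
have mR : 0 < m%:R :> R by rewrite ltr0n.
have dR : 0 < (d n)%:R :> R by rewrite ltr0n.
have r2 : 0 < rho n ^+ 2 by rewrite exprn_even_gt0.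
have /andP[q0 q2] := hq n.
have r0 : 0 < `|rho n| by rewrite normr_gt0.
have Ae : A * (alpha * eps) = 48 by rewrite /A divfK // mulf_neq0 ?gt_eqF.
have e1 : 12 * (n%:R / (m%:R * (d n)%:R * rho n ^+ 2)) < eps / 2.
  have p1 : 0 < m%:R * (d n)%:R * rho n ^+ 2.
    by apply: mulr_gt0 => //; exact: mulr_gt0.
  have p2 : 0 < rho n ^+ 2 * (d n)%:R by exact: mulr_gt0.
  rewrite mulrA ltr_pdivrMr //.
  have h1 : alpha * n%:R / 2 * (rho n ^+ 2 * (d n)%:R) <= m%:R * (rho n ^+ 2 * (d n)%:R).
    by rewrite ler_pM2r.
  have h2 : alpha * n%:R / 2 * A < alpha * n%:R / 2 * (rho n ^+ 2 * (d n)%:R).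
    by rewrite ltr_pM2l // divr_gt0 // mulr_gt0.
  have h3 : eps / 2 * (alpha * n%:R / 2 * A) < eps / 2 * (m%:R * (d n)%:R * rho n ^+ 2).
    by rewrite ltr_pM2l ?divr_gt0 //; lra.
  rewrite (_ : eps / 2 * (alpha * n%:R / 2 * A) = (A * (alpha * eps)) * n%:R / 4) in h3;
    last by field.
  by move: h3; rewrite Ae; lra.
have e2 : 4 / ((d n)%:R * m%:R * (`|rho n| * (q n * (1 - q n)))) < eps / 2.
  have qv : q n / 2 <= q n * (1 - q n) by rewrite ler_pM2l //; lra.
  have p0 : 0 < (d n)%:R * `|rho n| by rewrite mulr_gt0.
  have h0 : (alpha * n%:R / 2) * (q n / 2) <= m%:R * (q n * (1 - q n)).
    by apply: ler_pM => //; rewrite ?divr_ge0 ?mulr_ge0 // ltW.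
  have h1 : ((d n)%:R * `|rho n|) * ((alpha * n%:R / 2) * (q n / 2)) <=
      ((d n)%:R * `|rho n|) * (m%:R * (q n * (1 - q n))).
    by rewrite ler_pM2l.
  have h2 : alpha / 4 * A < alpha / 4 * (n%:R * (d n)%:R * q n * `|rho n|).
    by rewrite ltr_pM2l // divr_gt0.
  have h3 : alpha / 4 * A < (d n)%:R * m%:R * (`|rho n| * (q n * (1 - q n))) by lra.
  have h4 : 0 < (d n)%:R * m%:R * (`|rho n| * (q n * (1 - q n))).
    by apply: lt_trans h3; rewrite mulr_gt0 // divr_gt0.
  rewrite ltr_pdivrMr //.
  have : eps / 2 * (alpha / 4 * A) <
      eps / 2 * ((d n)%:R * m%:R * (`|rho n| * (q n * (1 - q n)))).
    by rewrite ltr_pM2l ?divr_gt0.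
  rewrite (_ : eps / 2 * (alpha / 4 * A) = (A * (alpha * eps)) / 8); last by field.
  by rewrite Ae; lra.
by rewrite [eps]splitr; exact: ltrD.
Qed.

(** * The balance statistic and detection in fixed dimension *)

Lemma nondecreasing_at0 (R : realType) (f df : R -> R) (a : R) :
  0 <= a -> (forall x : R, is_derive x 1 f (df x)) ->
  (forall x, 0 <= x <= a -> 0 <= df x) -> f 0 <= f a.
Proof.
move=> a0 f_df df0.
have cf : {within `[0, a], continuous f}.
  by apply: derivable_within_continuous => x _; exact: ex_derive.
have [c ca eq_f] := MVT_segment a0 (fun x _ => f_df x) cf.
rewrite -subr_ge0 eq_f mulr_ge0 ?subr_ge0 // df0 //.
Qed.

Lemma sin_le_id (R : realType) (x : R) : 0 <= x -> sin x <= x.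
Proof.
move=> x0; have D (y : R) : is_derive y 1 (fun z : R => z - sin z) (1 - cos y).
  by apply: is_derive_eq; rewrite /GRing.scale /=; ring.
have := nondecreasing_at0 x0 D; rewrite sin0 subrr subr_ge0; apply=> y _.
by rewrite subr_ge0 cos_le1.
Qed.

Lemma cos_ge_quadratic (R : realType) (x : R) : 1 - x ^+ 2 / 2 <= cos x.
Proof.
wlog x0 : x / 0 <= x.
  move=> H; have [/H //|x0] := lerP 0 x.
  by rewrite -cosN -[x]opprK sqrrN opprK; apply: H; rewrite oppr_ge0 ltW.
have D (y : R) : is_derive y 1 (fun z : R => cos z + z ^+ 2 / 2) (y - sin y).
  by apply: is_derive_eq; rewrite /GRing.scale /=; field.
have := nondecreasing_at0 x0 D; rewrite cos0 expr0n /= mul0r addr0 -lerBlDr.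
by apply=> y /andP[y0 _]; rewrite subr_ge0 sin_le_id.
Qed.

Lemma cos_le_quadratic (R : realType) (x : R) :
  `|x| <= 1 -> cos x <= 1 - x ^+ 2 / 4.
Proof.
wlog x0 : x / 0 <= x.
  move=> H; have [/H //|x0] := lerP 0 x.
  by rewrite -cosN -normrN -sqrrN; apply: H; rewrite oppr_ge0 ltW.
rewrite ger0_norm // => x1.
have sin_ge (y : R) : 0 <= y <= x -> y / 2 <= sin y.
  move=> /andP[y0 yx].
  have D (z : R) : is_derive z 1 (fun z : R => sin z - z / 2) (cos z - 1 / 2).
    by apply: is_derive_eq; rewrite /GRing.scale /=; field.
  have := nondecreasing_at0 y0 D; rewrite sin0 mul0r subrr subr_ge0; apply.
  move=> z /andP[z0 zy]; have := cos_ge_quadratic z.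
  have : z ^+ 2 <= 1 by rewrite expr_le1 //; lra.
  lra.
have D (y : R) : is_derive y 1 (fun z : R => - cos z - z ^+ 2 / 4) (sin y - y / 2).
  by apply: is_derive_eq; rewrite /GRing.scale /=; field.
have := nondecreasing_at0 x0 D; rewrite cos0 expr0n /= mul0r subr0 => H.
suff : -1 <= - cos x - x ^+ 2 / 4 by lra.
by apply: H => y yx; rewrite subr_ge0 sin_ge.
Qed.

(** In the coordinate [k], the difference ([sigma = 1]) or the sum
    ([sigma = -1]) of the centred numbers of ones of the two samples. *)
Definition balance_statistic (R : realType) (q sigma : R) (n m d : nat)
    (k : 'I_d) (x : {ffun 'I_n -> {ffun 'I_d -> bool}})
    (y : {ffun 'I_m -> {ffun 'I_d -> bool}}) : R :=
  \sum_j centred q x (j, k) - sigma * \sum_i centred q y (i, k).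

(** For [m = n] and [sigma] the sign of [rho] this is
    [2 * n * (1 - `|rho|) * (q * (1 - q))], much smaller than under the null when
    [rho ^+ 2] is close to [1]. *)
Lemma balance_statistic_second_moment (R : realType) (q rho sigma : R)
    (n m d : nat) (s : {ffun 'I_m -> 'I_n}) (k : 'I_d) :
  injective s -> sigma ^+ 2 = 1 ->
  planted_mean q rho s (fun x y => balance_statistic q sigma k x y ^+ 2) =
  (n%:R + m%:R - 2 * sigma * m%:R * rho) * (q * (1 - q)).
Proof.
move=> s_inj sigma2; set v := q * (1 - q).
rewrite (@planted_mean_ext _ _ _ _ _ _ _ _ (fun x y =>
  (\sum_j \sum_j' \prod_(t <- [:: (j, k); (j', k)]) centred q x t *
                  \prod_(u <- [::]) centred q y u) +
  ((- (2 * sigma)) * (\sum_j \sum_i \prod_(t <- [:: (j, k)]) centred q x t *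
                     \prod_(u <- [:: (i, k)]) centred q y u) +
  (\sum_i \sum_i' \prod_(t <- [::]) centred q x t *
                 \prod_(u <- [:: (i, k); (i', k)]) centred q y u)))); last first.
  move=> x y; rewrite /balance_statistic.
  set a := \sum_j centred q x (j, k); set b := \sum_i centred q y (i, k).
  transitivity (a ^+ 2 + ((- (2 * sigma)) * (a * b) + sigma ^+ 2 * b ^+ 2)).
    by ring.
  rewrite sigma2 mul1r; congr (_ + (_ * _ + _)).
  - rewrite expr2 mulr_suml; apply: eq_bigr => j _; rewrite mulr_sumr.
    by apply: eq_bigr => j' _; rewrite !big_cons !big_nil !mulr1.
  - rewrite mulr_suml; apply: eq_bigr => j _; rewrite mulr_sumr.
    by apply: eq_bigr => i _; rewrite !big_seq1.
  rewrite expr2 mulr_suml; apply: eq_bigr => i _; rewrite mulr_sumr.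
  by apply: eq_bigr => i' _; rewrite !big_cons !big_nil mul1r mulr1.
have XX (j j' : 'I_n) : planted_mean q rho s (fun x y =>
    \prod_(t <- [:: (j, k); (j', k)]) centred q x t *
    \prod_(u <- [::]) centred q y u) = (j' == j)%:R * v.
  by rewrite planted_mean_seq // prod_moments_xx xpair_eqE eqxx andbT eq_sym.
have XY (j : 'I_n) i : planted_mean q rho s (fun x y =>
    \prod_(t <- [:: (j, k)]) centred q x t *
    \prod_(u <- [:: (i, k)]) centred q y u) = (j == s i)%:R * (rho * v).
  by rewrite planted_mean_seq // prod_moments_xy xpair_eqE eqxx andbT.
have YY (i i' : 'I_m) : planted_mean q rho s (fun x y =>
    \prod_(t <- [::]) centred q x t *
    \prod_(u <- [:: (i, k); (i', k)]) centred q y u) = (i' == i)%:R * v.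
  rewrite planted_mean_seq // prod_moments_yy xpair_eqE eqxx andbT eq_sym.
  by rewrite (inj_eq s_inj).
rewrite 2!planted_meanD planted_meanZ !planted_mean_sum.
under eq_bigr do rewrite planted_mean_sum.
under eq_bigr do under eq_bigr do rewrite XX.
under [X in _ + (_ * X + _)]eq_bigr do rewrite planted_mean_sum.
under [X in _ + (_ * X + _)]eq_bigr do under eq_bigr do rewrite XY.
under [X in _ + (_ + X)]eq_bigr do rewrite planted_mean_sum.
under [X in _ + (_ + X)]eq_bigr do under eq_bigr do rewrite YY.
rewrite [X in _ + (_ * X + _)]exchange_big /=.
under eq_bigr do rewrite sum_indicator.
under [X in _ + (_ * X + _)]eq_bigr do rewrite sum_indicator.
under [X in _ + (_ + X)]eq_bigr do rewrite sum_indicator.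
rewrite !sumr_const !card_ord -[v *+ n]mulr_natl -[v *+ m]mulr_natl.
by rewrite -[(rho * v) *+ m]mulr_natl; ring.
Qed.

Local Open Scope complex_scope.

Definition cis (R : realType) (a : R) : R[i] := cos a +i* sin a.

Lemma cisD (R : realType) (a b : R) : cis (a + b) = cis a * cis b.
Proof.
apply/eqP; rewrite eq_complex /= cosD sinD eqxx /= addrC.
by rewrite [sin a * _]mulrC mulrC eqxx.
Qed.

Lemma cis0 (R : realType) : cis (0 : R) = 1.
Proof. by rewrite /cis cos0 sin0. Qed.

Lemma cis_sum (R : realType) (I : finType) (F : I -> R) :
  cis (\sum_i F i) = \prod_i cis (F i).
Proof. exact: (big_morph _ (@cisD R) (cis0 R)). Qed.

(** The squared modulus as an element of [R]: the norm of [R[i]] takes its values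
    in [R[i]]. *)
Definition normsq (R : realType) (z : R[i]) : R :=
  complex.Re z ^+ 2 + complex.Im z ^+ 2.

Lemma normsqM (R : realType) (z w : R[i]) : normsq (z * w) = normsq z * normsq w.
Proof. by case: z w => [a b] [c d]; rewrite /normsq /=; ring. Qed.

Lemma normsqX (R : realType) (z : R[i]) n : normsq (z ^+ n) = normsq z ^+ n.
Proof.
elim: n => [|n IH]; last by rewrite !exprS normsqM IH.
by rewrite !expr0 /normsq /=; ring.
Qed.

Lemma sum_complex (R : realType) (I : finType) (a b : I -> R) :
  \sum_i (a i +i* b i) = (\sum_i a i) +i* (\sum_i b i).
Proof. by elim/big_rec3: _ => [|i x y z _ ->]. Qed.

Lemma complex_scale (R : realType) (a b c : R) :
  (a%:C * (b +i* c)) = (a * b) +i* (a * c).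
Proof. by apply/eqP; rewrite eq_complex /= !mul0r subr0 addr0 !eqxx. Qed.

(** Squared modulus of the characteristic function of a centred Bernoulli
    variable. *)
Lemma normsq_bernoulli (R : realType) (q u : R) :
  normsq (\sum_b (bernoulli q b)%:C * cis (u * (b%:R - q))) =
  1 - 2 * (q * (1 - q)) * (1 - cos u).
Proof.
rewrite big_bool /= /cis !complex_scale /=.
rewrite [u * (1%:R - q)](_ : _ = u * (0%:R - q) + u); last by ring.
set a := u * (0%:R - q); rewrite cosD sinD /normsq /=.
have := cos2Dsin2 a; have := cos2Dsin2 u.
move: (cos a) (sin a) (cos u) (sin u) => ca sa cu su hu ha.
have -> : (q * (ca * cu - sa * su) + (1 - q) * ca) ^+ 2 +
   (q * (sa * cu + ca * su) + (1 - q) * sa) ^+ 2 =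
   (ca ^+ 2 + sa ^+ 2) * (q ^+ 2 * (cu ^+ 2 + su ^+ 2) + (1 - q) ^+ 2 +
      2 * (q * (1 - q)) * cu) by ring.
by rewrite hu ha; ring.
Qed.

(** The characteristic function of a sum of independent variables is the
    product of theirs, and squared moduli multiply.  Both signs of [sigma] give
    the same modulus. *)
Lemma null_characteristic (R : realType) (q sigma u : R) (n m d : nat)
    (s : {ffun 'I_m -> 'I_n}) (k : 'I_d) :
  injective s -> sigma = 1 \/ sigma = -1 ->
  planted_mean q 0 s (fun x y => cos (u * balance_statistic q sigma k x y)) ^+ 2 +
  planted_mean q 0 s (fun x y => sin (u * balance_statistic q sigma k x y)) ^+ 2 =
  (1 - 2 * (q * (1 - q)) * (1 - cos u)) ^+ (n + m).
Proof.
move=> s_inj sigma1.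
pose g (c : R) (a : {ffun 'I_d -> bool}) : R[i] :=
  (\prod_l bernoulli q (a l))%:C * cis (c * ((a k)%:R - q)).
pose w (x : {ffun 'I_n -> {ffun 'I_d -> bool}})
  (y : {ffun 'I_m -> {ffun 'I_d -> bool}}) : R :=
  planted_law_given (@iid_pair R (bernoulli_pair q 0) d) s x y.
have gE c : \sum_a g c a = \sum_b (bernoulli q b)%:C * cis (c * (b%:R - q)).
  pose h l b : R[i] := (bernoulli q b)%:C *
    (if l == k then cis (c * (b%:R - q)) else 1).
  transitivity (\sum_(a : {ffun 'I_d -> bool}) \prod_l h l (a l)).
    apply: eq_bigr => a _; rewrite /g /h rmorph_prod big_split /=; congr (_ * _).
    by rewrite -big_mkcond big_pred1_eq.
  rewrite -(bigA_distr_bigA h) (bigD1 k) //= [X in _ * X]big1 => [|l /negPf lk].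
    by rewrite mulr1; apply: eq_bigr => b _; rewrite /h eqxx.
  rewrite /h lk; under eq_bigr do rewrite mulr1.
  by apply/eqP; rewrite big_bool eq_complex /= addrC subrK addr0 !eqxx.
pose Z := \sum_x \sum_y (w x y)%:C * cis (u * balance_statistic q sigma k x y).
transitivity (normsq Z).
  rewrite /Z /cis; under eq_bigr do under eq_bigr do rewrite complex_scale.
  under eq_bigr do rewrite sum_complex.
  by rewrite sum_complex.
have -> : Z = (\sum_a g u a) ^+ n * (\sum_a g (- (u * sigma)) a) ^+ m.
  rewrite -[n in RHS]card_ord -[m in RHS]card_ord -!prodr_const !bigA_distr_bigA /=.
  rewrite mulr_suml; apply: eq_bigr => x _; rewrite mulr_sumr; apply: eq_bigr => y _.
  rewrite /w -(null_law_planted q 0) // /null_law /g !big_split /= -!rmorph_prod.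
  rewrite mulrACA -rmorphM /= -!cis_sum -cisD; congr (_%:C * cis _).
    congr (_ * _); apply: eq_bigr => i _.
      rewrite iid_pair_marginalX; apply: eq_bigr => l _.
      by rewrite bernoulli_pair_marginalX.
    rewrite iid_pair_marginalY; apply: eq_bigr => l _.
    by rewrite bernoulli_pair_marginalY.
  rewrite /balance_statistic /centred /= mulrBr mulrA mulr_sumr -mulNr mulr_sumr.
  by congr (_ + _); apply: eq_bigr => i _; rewrite ?mulNr.
rewrite normsqM !normsqX !gE !normsq_bernoulli cosN exprD; congr (_ * (1 - _ * (1 - _)) ^+ _).
by case: sigma1 => ->; rewrite ?mulr1 // mulrN1 cosN.
Qed.

Local Close Scope complex_scope.

(** The Fejer kernel [|\sum_j exp (i j t z)| ^ 2]: nonnegative, of order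
    [T ^+ 2] near [z = 0], and with a mean of order [T] when [z] is spread out. *)
Definition fejer (R : realType) (T : nat) (t z : R) : R :=
  \sum_(i < T) \sum_(j < T) cos ((i%:R - j%:R) * t * z).

Lemma fejer_ge0 (R : realType) (T : nat) (t z : R) : 0 <= fejer T t z.
Proof.
have -> : fejer T t z = (\sum_(i < T) cos (i%:R * (t * z))) ^+ 2 +
                        (\sum_(i < T) sin (i%:R * (t * z))) ^+ 2.
  rewrite !expr2 !mulr_suml -big_split; apply: eq_bigr => i _ /=.
  rewrite !mulr_sumr -big_split; apply: eq_bigr => j _ /=.
  by rewrite -cosB -mulrBl mulrA.
by rewrite addr_ge0 ?sqr_ge0.
Qed.

Lemma ord_dist_le (R : realType) (T : nat) (i j : 'I_T) :
  `|i%:R - j%:R| <= T%:R :> R.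
Proof.
have := ltn_ord i; have := ltn_ord j; rewrite -!(ltr_nat R) => hj hi.
have := ler0n R i; have := ler0n R j; rewrite ler_norml => i0 j0.
by apply/andP; split; lra.
Qed.

Lemma ord_dist_ge (R : realType) (T : nat) (i j : 'I_T) :
  i != j -> 1 <= `|i%:R - j%:R| :> R.
Proof.
move=> ij; wlog lt_ij : i j ij / (j < i)%N.
  move=> H; move: (ij); rewrite -val_eqE neq_ltn => /orP[lt_ij|]; last exact: H.
  by rewrite distrC; apply: H => //; rewrite eq_sym.
apply: le_trans (ler_norm _).
by rewrite lerBrDr addrC -[1]/(1%:R) -natrD ler_nat addn1.
Qed.

Lemma fejer_ge (R : realType) (T : nat) (t z : R) :
  `|T%:R * t * z| <= 1 -> T%:R ^+ 2 / 2 <= fejer T t z.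
Proof.
move=> small.
have -> : T%:R ^+ 2 / 2 = \sum_(i < T) \sum_(j < T) (1 / 2 : R).
  by rewrite !sumr_const !card_ord -[(1 / 2) *+ T]mulr_natl -[LHS]mulr1
    -[RHS]mulr_natl; field.
apply: ler_sum => i _; apply: ler_sum => j _.
apply: le_trans (cos_ge_quadratic _).
have : `|(i%:R - j%:R) * t * z| <= 1.
  apply: le_trans small; rewrite -!mulrA !normrM ler_wpM2r ?mulr_ge0 //.
  by rewrite [leRHS]ger0_norm ?ler0n // ord_dist_le.
move=> le1; have : ((i%:R - j%:R) * t * z) ^+ 2 <= 1.
  by rewrite -real_normK ?num_real // expr_le1.
lra.
Qed.

Lemma expr_le_inv (R : realType) (x : R) (n : nat) :
  0 <= x -> x <= 1 -> (1 - x) ^+ n <= (1 + n%:R * x)^-1.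
Proof.
move=> x0 x1.
have nx0 : 0 < 1 + n%:R * x by rewrite ltr_pwDl // mulr_ge0.
apply: (@le_trans _ _ (expR (- x) ^+ n)).
  apply: lerXn2r; rewrite ?nnegrE ?expR_ge0 ?subr_ge0 //; exact: expR_ge1Dx.
rewrite -expRM_natl mulrN expRN lef_pV2 ?posrE ?expR_gt0 //; exact: expR_ge1Dx.
Qed.

(** The modulus of the characteristic function is
    [(1 - 2 * (q * (1 - q)) * (1 - cos u)) ^+ n], and [1 - cos u >= u ^+ 2 / 4] for
    [`|u| <= 1]. *)
Lemma null_cos_le (R : realType) (q sigma u t : R) (n d : nat)
    (s : {ffun 'I_n -> 'I_n}) (k : 'I_d) :
  0 < q <= 1 / 2 -> injective s -> sigma = 1 \/ sigma = -1 ->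
  0 <= t <= `|u| -> `|u| <= 1 ->
  planted_mean q 0 s (fun x y => cos (u * balance_statistic q sigma k x y)) <=
  (1 + n%:R * (q * (1 - q) * t ^+ 2 / 2))^-1.
Proof.
move=> /andP[q0 q2] s_inj sigma1 /andP[t0 tu] u1.
have := null_characteristic q u k s_inj sigma1.
set C := planted_mean _ _ _ _; set D := planted_mean _ _ _ _ => CD.
set v := q * (1 - q) in CD *; set g := 1 - 2 * v * (1 - cos u) in CD.
have v0 : 0 < v by rewrite /v; nra.
have v4 : v <= 1 / 4.
  by rewrite /v; have := sqr_ge0 (q - 1 / 2); nra.
have g0 : 0 <= g by rewrite /g; have := cos_geN1 u; have := cos_le1 u; nra.
have tu2 : t ^+ 2 <= u ^+ 2.
  by rewrite -[u ^+ 2]real_normK ?num_real //; apply: lerXn2r; rewrite ?nnegrE.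
have t1 : t ^+ 2 <= 1 by rewrite expr_le1 //; apply: le_trans u1.
have gt : g <= 1 - v * t ^+ 2 / 2.
  have := cos_le_quadratic u1 => cu.
  have : v * t ^+ 2 <= v * u ^+ 2 by rewrite ler_pM2l.
  have : v * (u ^+ 2 / 4) <= v * (1 - cos u) by rewrite ler_pM2l //; lra.
  by rewrite /g; lra.
have t2 := sqr_ge0 t.
apply: le_trans (expr_le_inv n _ _); last 2 first.
- by rewrite divr_ge0 // mulr_ge0 // ltW.
- nra.
apply: (@le_trans _ _ (g ^+ n)); last by apply: lerXn2r; rewrite ?nnegrE; lra.
have gn0 : 0 <= g ^+ n by exact: exprn_ge0.
have CC : C ^+ 2 <= (g ^+ n) ^+ 2.
  by rewrite -exprM muln2 -addnn -CD lerDl sqr_ge0.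
rewrite leNgt; apply/negP => lt_gC; move: CC; apply/negP; rewrite -ltNge.
by rewrite ltrXn2r // ?nnegrE // ltW // (le_lt_trans gn0).
Qed.

(** Reject when the statistic is small.  Under the null the Fejer kernel bounds
    the probability of a small value, which a variance bound cannot do; under the
    alternative Chebyshev's inequality shows that the value is small. *)
Lemma balance_test_errors (R : realType) (q rho t : R) (n d T : nat) (k : 'I_d) :
  0 < q <= 1 / 2 -> - (q / (1 - q)) <= rho <= 1 -> (0 < T)%N ->
  0 < t -> T%:R * t <= 1 ->
  exists phi : {ffun 'I_n -> {ffun 'I_d -> bool}} ->
               {ffun 'I_n -> {ffun 'I_d -> bool}} -> bool,
    type1_error (@iid_pair R (bernoulli_pair q rho) d) phi +
    type2_error (@iid_pair R (bernoulli_pair q rho) d) phi <=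
    2 * (T%:R^-1 + (1 + n%:R * (q * (1 - q) * t ^+ 2 / 2))^-1) +
    2 * (T%:R * t) ^+ 2 * (n%:R * (q * (1 - q))) * (1 - `|rho|).
Proof.
move=> hq hrho T0 t0 Tt1.
have TR : 0 < T%:R :> R by rewrite ltr0n.
(* With this sign the planted variance is a multiple of [1 - `|rho|]. *)
pose sigma : R := if 0 <= rho then 1 else -1.
have sigma1 : sigma = 1 \/ sigma = -1 by rewrite /sigma; case: ifP; [left|right].
have sigma2 : sigma ^+ 2 = 1 by case: sigma1 => ->; rewrite ?sqrrN expr1n.
have sigma_rho : sigma * rho = `|rho|.
  by rewrite /sigma; case: ger0P; rewrite ?mul1r ?mulN1r.
pose S := @balance_statistic R q sigma n n d k.
exists (fun x y => `|T%:R * t * S x y| <= 1).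
have [s0 /inj_injections s0_inj] := injections_exists (leqnn n).
apply: lerD.
  (* The [T] diagonal terms contribute [1] each, and dividing the sum by the
     lower bound [T ^+ 2 / 2] of the kernel gives [2 / T] and [2 * B]. *)
  have T2 : 0 < T%:R ^+ 2 / 2 :> R by rewrite divr_gt0 // exprn_gt0.
  apply: le_trans (type1_error_le rho hq s0_inj T2
    (F := fun x y => fejer T t (S x y)) _ _) _.
  - by move=> x y; exact: fejer_ge0.
  - by move=> x y; exact: fejer_ge.
  set B := (1 + n%:R * _)^-1.
  have B0 : 0 <= B.
    have v0 : 0 <= q * (1 - q) by move: hq => /andP[]; nra.
    rewrite invr_ge0; apply: addr_ge0 => //; apply: mulr_ge0 => //.
    by apply: divr_ge0 => //; apply: mulr_ge0 v0 _; exact: sqr_ge0.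
  rewrite ler_pdivrMr // planted_mean_sum.
  apply: (@le_trans _ _ (\sum_(i < T) \sum_(j < T) ((j == i)%:R * 1 + B))).
    apply: ler_sum => i _; rewrite planted_mean_sum; apply: ler_sum => j _.
    have [->|ij] := eqVneq j i.
      rewrite (@planted_mean_ext _ _ _ _ _ _ _ _ (fun _ _ => 1)) => [|x y].
        by rewrite planted_mean_cst // mul1r lerDl.
      by rewrite subrr !mul0r cos0.
    rewrite mul0r add0r; apply: null_cos_le => //.
      rewrite (ltW t0) /= normrM [`|t|]gtr0_norm //.
      by apply: ler_peMl; [exact: ltW | apply: ord_dist_ge; rewrite eq_sym].
    apply: le_trans Tt1; rewrite normrM [`|t|]gtr0_norm // ler_pM2r //.
    exact: ord_dist_le.
  under eq_bigr do rewrite big_split /= sum_indicator sumr_const card_ord.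
  rewrite sumr_const card_ord -[B *+ T]mulr_natl -[leLHS]mulr_natl.
  by rewrite le_eqVlt; apply/orP; left; apply/eqP; field; rewrite gt_eqF.
rewrite -[leRHS]divr1; apply: (type2_error_le hq hrho (leqnn n) ltr01
  (F := fun x y => (T%:R * t * S x y) ^+ 2)).
- by move=> x y; exact: sqr_ge0.
- move=> x y; rewrite -ltNge => /ltW ge1.
  by rewrite -real_normK ?num_real // expr_ge1.
move=> s s_inj.
rewrite (@planted_mean_ext _ _ _ _ _ _ _ _
  (fun x y => (T%:R * t) ^+ 2 * S x y ^+ 2)) => [|x y]; last by rewrite exprMn.
rewrite planted_meanZ balance_statistic_second_moment // -sigma_rho.
by rewrite le_eqVlt; apply/orP; left; apply/eqP; ring.
Qed.

(** Fix [T] of order [1 / eps], then take [t] with [t ^+ 2 * n * q * (1 - q)] fixed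
    and of order [1 / eps], so that both parts of the type I error are at most
    [eps / 8]; the type II error is then at most a fixed multiple of [1 - `|rho|]. *)
Lemma detection_fixed (R : realType) (q rho : nat -> R) (d : nat) :
  (0 < d)%N -> (forall n, 0 < q n <= 1 / 2) ->
  (forall n, - (q n / (1 - q n)) <= rho n <= 1 /\ `|rho n| <= 1) ->
  rho n ^+ 2 @[n --> \oo] --> (1 : R) -> n%:R * q n @[n --> \oo] --> +oo ->
  bernoulli_strong_detection 1 q rho (fun=> d).
Proof.
move=> d0 hq hrho corr count; apply: detection_of_errors.
  move=> n u v; apply: iid_pair_ge0 => a b.
  by apply: bernoulli_pair_ge0 => //; case: (hrho n).
move=> eps eps0; pose M : R := 16 / eps.
have M0 : 0 < M by rewrite divr_gt0.
pose T := (Num.truncn M).+1.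
have TM : M < T%:R by case/andP: (truncn_itv (ltW M0)).
have TR : 0 < T%:R :> R by rewrite ltr0n.
have MT0 : 0 < M * T%:R ^+ 2 by apply: mulr_gt0 => //; exact: exprn_gt0.
pose delta : R := eps / (16 * (M * T%:R ^+ 2)).
have delta0 : 0 < delta.
  by apply: divr_gt0 => //; exact: mulr_gt0.
have {}corr := (@cvgrPdist_lt _ _ _ _ eventually_filter _ _).1 corr _ delta0.
have {}count := (@cvgryPgt _ _ _ eventually_filter _).1 count (4 * (M * T%:R ^+ 2)).
apply: filterS2 corr count => n corr count.
have -> : Num.truncn (1 * n%:R : R) = n by rewrite mul1r natrK.
have [hrho1 hrho2] := hrho n; have /andP[q0 q2] := hq n.
set v := q n * (1 - q n).
have qv : q n / 2 <= v by rewrite /v ler_pM2l //; lra.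
have n0 : 0 < n%:R :> R.
  rewrite ltr0n lt0n; apply: contraTneq count => ->.
  by rewrite mul0r ltNge negbK mulr_ge0 // ltW.
have nv : 2 * (M * T%:R ^+ 2) <= n%:R * v.
  have : n%:R * (q n / 2) <= n%:R * v by rewrite ler_pM2l.
  lra.
have v0 : 0 < v by apply: lt_le_trans qv; rewrite divr_gt0.
have nv0 : 0 < n%:R * v by exact: mulr_gt0.
have MN : 0 < 2 * M / (n%:R * v) by apply: divr_gt0 => //; exact: mulr_gt0.
pose t : R := Num.sqrt (2 * M / (n%:R * v)).
have t2 : t ^+ 2 = 2 * M / (n%:R * v).
  by rewrite sqr_sqrtr // ltW.
have t0 : 0 < t by rewrite sqrtr_gt0.
have Tt2 : (T%:R * t) ^+ 2 = 2 * (M * T%:R ^+ 2) / (n%:R * v).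
  by rewrite exprMn t2; field; rewrite !gt_eqF.
have Tt1 : T%:R * t <= 1.
  have Tt0 : 0 <= T%:R * t by rewrite mulr_ge0 // ltW.
  rewrite -(@expr_le1 _ 2) // Tt2 ler_pdivrMr // mul1r //.
have [phi err] := balance_test_errors n (Ordinal d0) (hq n) hrho1 (ltn0Sn _) t0 Tt1.
exists phi; apply: le_lt_trans err _; rewrite -/v Tt2 t2.
have -> : n%:R * (v * (2 * M / (n%:R * v)) / 2) = M.
  by field; rewrite !gt_eqF.
have -> : 2 * (2 * (M * T%:R ^+ 2) / (n%:R * v)) * (n%:R * v) * (1 - `|rho n|) =
    4 * (M * T%:R ^+ 2) * (1 - `|rho n|).
  by field; rewrite !gt_eqF.
have b1 : T%:R^-1 <= M^-1 by rewrite lef_pV2 ?posrE // ltW.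
have b2 : (1 + M)^-1 <= M^-1 by rewrite lef_pV2 ?posrE // ?lerDr // addr_gt0.
have Mi : M^-1 = eps / 16 by rewrite /M invf_div.
have b3 : 1 - `|rho n| <= delta.
  have : 1 - rho n ^+ 2 < delta by apply: le_lt_trans corr; exact: ler_norm.
  have : rho n ^+ 2 <= `|rho n|.
    by rewrite -real_normK ?num_real // expr2 ler_piMl.
  lra.
have b4 : 4 * (M * T%:R ^+ 2) * (1 - `|rho n|) <= eps / 4.
  rewrite (_ : eps / 4 = 4 * (M * T%:R ^+ 2) * delta).
    by rewrite ler_pM2l // mulr_gt0.
  by rewrite /delta; field; rewrite !gt_eqF.
move: b1 b2 b4; rewrite Mi.
by move: (T%:R^-1) ((1 + M)^-1) (4 * _ * _) => x y z; lra.
Qed.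

(** * The detection threshold *)

Theorem corollary3 (R : realType) (alpha : R) (q rho : nat -> R)
    (halpha : 0 < alpha <= 1)
    (hq : forall n : nat, 0 < q n <= 1 / 2)
    (hrho : forall n : nat,
      - Num.min (q n / (1 - q n)) ((1 - q n) / q n) <= rho n <= 1) :
  (forall d : nat, (0 < d)%N ->
     (bernoulli_strong_detection alpha q rho (fun=> d) <->
      [/\ alpha = 1,
          (rho n ^+ 2 @[n --> \oo] --> (1 : R)) &
          (n%:R * q n @[n --> \oo] --> +oo)])) /\
  (forall d : nat -> nat, (d n @[n --> \oo] --> \oo) ->
     (bernoulli_strong_detection alpha q rho d <->
      (rho n ^+ 2 * (d n)%:R @[n --> \oo] --> +oo) /\
      (n%:R * (d n)%:R * q n * `|rho n| @[n --> \oo] --> +oo))).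
Proof.
have hrho' n := correlation_bounds (hq n) (hrho n).
have rho1 n : `|rho n| <= 1 by case: (hrho' n).
have rho2 n : rho n ^+ 2 <= 1.
  by rewrite -real_normK ?num_real // expr_le1.
split=> [d d0 | d dn]; split.
- move=> detect; have corr := detection_fixed_correlation halpha hq rho1 detect.
  have /andP[a0 a1] := halpha.
  split.
  + apply/eqP; rewrite eq_le a1 /=; apply/ler_addgt0Pr => e e0.
    have [n _ /(_ n (leqnn n)) lt_n] := corr e e0.
    have : alpha * rho n ^+ 2 <= alpha by rewrite ler_piMr // ltW.
    lra.
  + apply/cvgrPdist_lt => e e0; apply: filterS (corr e e0) => n lt_n.
    have : alpha * rho n ^+ 2 <= rho n ^+ 2 by rewrite ler_piMl ?sqr_ge0.
    rewrite ger0_norm ?subr_ge0 //; lra.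
  apply/cvgryPge => A.
  have := detection_signal halpha hq hrho' detect.
  move=> /(@cvgryPge _ _ _ eventually_filter _)/(_ (A * d%:R)).
  apply: filterS => n le_A.
  have dR : 0 < d%:R :> R by rewrite ltr0n.
  rewrite -(ler_pM2r dR); apply: le_trans le_A _.
  have /andP[q0 _] := hq n.
  rewrite [n%:R * d%:R * q n]mulrAC; apply: ler_piMr => //.
  by apply: mulr_ge0 => //; apply: mulr_ge0 => //; exact: ltW.
- by move=> [-> corr count]; exact: detection_fixed.
- move=> detect; split; first exact: detection_large_correlation halpha hq dn detect.
  exact: detection_signal halpha hq hrho' detect.
by move=> [corr signal]; exact: detection_large.
Qed.
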